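(* For each $N$, let $\boldsymbol{y}_N = \boldsymbol{m}_N^0 + \boldsymbol{\varepsilon}_N \in\mathbb{R}^N$, where $\boldsymbol{m}_N^0\in\mathbb{R}^N$ is deterministic and $\boldsymbol{\varepsilon}_N$ is a random vector of independent, zero mean, sub-exponential, continuous components such that $\kappa := \sup_{N\in\mathbb{N}} \max_{1\le i\le N} \|(\boldsymbol{\varepsilon}_N)_i\|_{\psi_1} < \infty$. Let $1=t_0^0<t_1^0<\cdots<t_{M^0-1}^0<t_{M^0}^0=N+1$, where $t_1^0,\dots,t_{M^0-1}^0$ are the change points of $\boldsymbol{m}_N^0$ (these quantities may depend on $N$), write $m_t^0 := (\boldsymbol{m}_N^0)_t$, and let $s_k := \mathrm{sgn}(m^0_{t_k^0}-m^0_{t_{k-1}^0})$, $k=1,\dots,M^0-1$. Suppose that there are positive constants $M_1,\dots,M_5$ and $c_1$, independent of $N$, such that: (a) $M^0\leq M_1$; (b) $\min_{k=1,\dots,M^0} (t_k^0-t_{k-1}^0)\geq M_2 N$; (c) $0<M_3\leq \min_{k=1,\dots,M^0-1} |m^0_{t_k^0}-m^0_{t_k^0-1}|\leq M_4$; (d) $\lambda_N = M_5 N^{c_1}$ with $1/2<c_1<1$; (e) all consecutive signs are different, i.e. $s_k=-s_{k+1}$ for all $k=1,\dots,M^0-2$. Let $\boldsymbol{m}_N$ be the optimal solution of the FLSA problem with data $\boldsymbol{y}_N$ and $\lambda=\lambda_N$, and let $\boldsymbol{x}_N,\boldsymbol{x}_N^0\in\mathbb{R}^{N-1}$ be the difference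 vectors $(\boldsymbol{x}_N)_t := (\boldsymbol{m}_N)_{t+1}-(\boldsymbol{m}_N)_t$ and $(\boldsymbol{x}_N^0)_t := (\boldsymbol{m}_N^0)_{t+1}-(\boldsymbol{m}_N^0)_t$, $t=1,\dots,N-1$. Then $\boldsymbol{m}_N$ is $\varepsilon$-sign-consistent, i.e. for all $\varepsilon,\gamma>0$ there is $N_0\in\mathbb{N}$ such that for all $N\geq N_0$, with probability at least $1-\gamma$, both of the following hold: - $(\boldsymbol{x}_N)_k = 0$ for every $k\in\{1,\dots,N-1\}\setminus K_N^\varepsilon$; - for every $i\in K_N^0 := \mathrm{supp}(\boldsymbol{x}_N^0)$ there is a $k\in I_i^{\varepsilon,N}$ such that $\mathrm{sgn}((\boldsymbol{x}_N)_k)=\mathrm{sgn}((\boldsymbol{x}_N^0)_i)$; where $I_i^{\varepsilon,N} := \{k\in\{1,\dots,N-1\}: |k-i|<\varepsilon N\}$ for $i\in\{1,\dots,N-1\}$, and $K_N^\varepsilon := \bigcup_{i\in K_N^0} I_i^{\varepsilon,N}$.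
   Context: For data $\boldsymbol{y}=[y_1,\dots,y_N]^T$ and $\lambda>0$, the FLSA (fused lasso signal approximator) problem is $$\min_{m_1,\dots,m_N} \frac12\sum_{t=1}^N (y_t-m_t)^2 + \lambda\sum_{t=2}^N |m_t-m_{t-1}|.$$ A change point of a vector $\boldsymbol{m}\in\mathbb{R}^N$ is an index $t\in\{2,\dots,N\}$ with $m_t\neq m_{t-1}$. A random variable $x$ is sub-exponential if $(E|x|^p)^{1/p}\leq K p$ for all $p\geq1$ and some constant $K>0$ (not to be confused with heavy-tailed ''subexponential'' distributions); its sub-exponential norm is $\|x\|_{\psi_1} := \sup_{p\geq1} p^{-1}(E|x|^p)^{1/p}$. ''Continuous'' means having a continuous distribution. $\mathrm{supp}$ denotes the set of indices of nonzero entries. *)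

(* Defs.v *)
From mathcomp Require Import all_boot all_order all_algebra.
From mathcomp Require Import all_classical all_reals all_analysis.
Import Order.TTheory GRing.Theory Num.Theory.
Import numFieldNormedType.Exports.

Set Implicit Arguments.
Unset Strict Implicit.
Unset Printing Implicit Defensive.

Local Open Scope classical_set_scope.
Local Open Scope ring_scope.

(* All indices start at 0: the mathematical entry m_t, 1 <= t <= N, is
   entry m t.-1.  The default value 0 for t >= N is never used below. *)
Definition entry (R : realType) (N : nat) (m : 'cV[R]_N) (t : nat) : R :=
  if insub t is Some i then m i 0 else 0.

Definition diffv (R : realType) (N : nat) (m : 'cV[R]_N) : 'cV[R]_N.-1 :=
  \col_(t < N.-1) (entry m t.+1 - entry m t).

Definition supp (R : realType) (n : nat) (x : 'cV[R]_n) : {set 'I_n} :=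
  [set i | x i 0 != 0]%SET.

Definition flsa_objective (R : realType) (N : nat) (y : 'cV[R]_N) (lam : R)
    (m : 'cV[R]_N) : R :=
  2^-1 * \sum_(t < N) (y t 0 - m t 0) ^+ 2
  + lam * \sum_(1 <= t < N) `|entry m t - entry m t.-1|.

Definition flsa_solution (R : realType) (N : nat) (y : 'cV[R]_N) (lam : R)
    (m : 'cV[R]_N) : Prop :=
  forall m' : 'cV[R]_N, flsa_objective y lam m <= flsa_objective y lam m'.

Definition change_point (R : realType) (N : nat) (m : 'cV[R]_N) (t : nat) : bool :=
  (0 < t < N)%N && (entry m t != entry m t.-1).

(* t 1 < ... < t M.-1 are exactly the change points of m, completed by
   t 0 = 0 and t M = N (1 and N + 1 with indices starting at 1). *)
Definition change_points (R : realType) (N : nat) (m : 'cV[R]_N) (M : nat)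
    (t : nat -> nat) : Prop :=
  [/\ t 0%N = 0%N,
      t M = N,
      forall k, (k < M)%N -> (t k < t k.+1)%N &
      forall j, change_point m j <-> exists2 k, (1 <= k <= M.-1)%N & j = t k].

Definition jump_sign (R : realType) (N : nat) (m : 'cV[R]_N) (t : nat -> nat)
    (k : nat) : R :=
  Num.sg (entry m (t k) - entry m (t k.-1)).

Section random_variables.
Context {d : measure_display} {T : measurableType d} {R : realType}.
Variable P : probability T R.

(* 'N[P]_p[X] = (E |X|^p)^(1/p) *)
Definition sub_exponential (X : {RV P >-> R}) : Prop :=
  exists2 K : R, 0 < K &
    forall p : R, 1 <= p -> ('N[P]_(p%:E)[EFin \o X] <= (K * p)%:E)%E.

Definition psi1_norm (X : {RV P >-> R}) : \bar R :=
  ereal_sup [set ((p^-1)%:E * 'N[P]_(p%:E)[EFin \o X])%E | p in [set p : R | 1 <= p]].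

(* No atoms; absolute continuity is not required. *)
Definition continuous_rv (X : {RV P >-> R}) : Prop := continuous (cdf X).

Definition independent_rvs (I : finType) (X : I -> {RV P >-> R}) : Prop :=
  forall (J : {set I}) (B : I -> set R),
    (forall i, i \in J -> measurable (B i)) ->
    P [set w | forall i, i \in J -> B i (X i w)]
      = (\prod_(i in J) P (X i @^-1` B i))%E.

End random_variables.

Definition index_nbhd (R : realType) (N : nat) (e : R) (i : 'I_N.-1) :
    {set 'I_N.-1} :=
  [set k : 'I_N.-1 | `|k%:R - i%:R| < e * N%:R]%SET.

Definition supp_nbhd (R : realType) (N : nat) (e : R) (x0 : 'cV[R]_N.-1) :
    {set 'I_N.-1} :=
  (\bigcup_(i in supp x0) index_nbhd e i)%SET.

Definition approx_same_signs (R : realType) (N : nat) (e : R)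
    (x x0 : 'cV[R]_N.-1) : Prop :=
  (forall k, k \notin supp_nbhd e x0 -> x k 0 = 0) /\
  (forall i, i \in supp x0 ->
     exists2 k, k \in index_nbhd e i & Num.sg (x k 0) = Num.sg (x0 i 0)).

Definition eps_sign_consistent (R : realType) (d : nat -> measure_display)
    (T : forall N, measurableType (d N)) (P : forall N, probability (T N) R)
    (m : forall N, T N -> 'cV[R]_N) (m0 : forall N, 'cV[R]_N) : Prop :=
  forall e gamma : R, 0 < e -> 0 < gamma ->
    exists N0 : nat, forall N : nat, (0 < N)%N -> (N0 <= N)%N ->
      ((1 - gamma)%:E
        <= P N [set w | approx_same_signs e (diffv (m N w)) (diffv (m0 N))])%E.

(* Main.v *)
(* With S k the sum of y_t - m_t over t < k, optimality of m says: S vanishes at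
   both ends, |S| <= lam, and S = -lam (resp. lam) wherever m jumps up (resp.
   down).  The noise enters S only through its partial sums, which with high
   probability are all at most a small multiple of lam: the Rademacher-Menshov
   inequality loses log^2 N, which N^(2 c1 - 1) absorbs, and it needs only
   uncorrelated noise.

   If m jumped up far from every change point, then, balancing m against the
   constant signal on that segment, m would be almost equal to the signal and
   S almost equal to -lam at both ends of the segment, which is impossible at
   the ends 0 and N.  As the signs of the jumps alternate, the signal drops at
   one of the two ends; beyond that end S would be pushed below -lam before m can
   jump down, since a jump down needs S = lam.  Conversely, if m did not jump up
   within eps N of an upward change point, S would vary there by an amount of
   order N, while |S| <= lam = o(N). *)
Require Import Defs.
From mathcomp Require Import all_boot all_order all_algebra.
From mathcomp Require Import all_classical all_reals all_analysis.
From mathcomp Require Import measurable_realfun ring lra zify.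
Import Order.TTheory GRing.Theory Num.Theory.
Import numFieldNormedType.Exports.

Set Implicit Arguments.
Unset Strict Implicit.
Unset Printing Implicit Defensive.

Local Open Scope classical_set_scope.
Local Open Scope ring_scope.

(** * Deterministic analysis of the fit *)

(* [S] is the dual certificate of the fit [m] to the signal [mu] plus noise, and
   [W] the partial sums of the noise; [W 0 = 0] is not required, so that the
   notion is stable under [dual_string_flip]. *)
Record dual_string (R : realFieldType) (N : nat) (lam delta : R)
    (mu m S W : nat -> R) : Prop := DualString {
  ds_start : S 0%N = 0;
  ds_end : S N = 0;
  ds_bound : forall k, (k <= N)%N -> `|S k| <= lam;
  ds_up : forall k, (0 < k < N)%N -> m k.-1 < m k -> S k = - lam;
  ds_down : forall k, (0 < k < N)%N -> m k < m k.-1 -> S k = lam;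
  ds_noise : forall k, (k <= N)%N -> `|W k| <= delta;
  ds_incr : forall k, (k < N)%N ->
    S k.+1 - S k = W k.+1 - W k + (mu k - m k) }.

(* [lia] gets slow when it has to preprocess real-valued hypotheses. *)
Ltac nat_lia :=
  repeat match goal with
  | H : is_true (@Order.le _ _ _ _) |- _ => clear H
  | H : is_true (@Order.lt _ _ _ _) |- _ => clear H
  | H : @eq ?T _ _ |- _ =>
      lazymatch T with nat => fail | bool => fail | _ => clear H end
  | H : ?A |- _ =>
      lazymatch type of A with
      | Prop => lazymatch A with
        | forall _, _ => clear H
        | _ \/ _ => clear H
        | dual_string _ _ _ _ _ _ _ => clear H
        end
      end
  end; lia.

Lemma dual_string_opp (R : realFieldType) (N : nat) (lam delta : R)
    (mu m S W : nat -> R) :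
  dual_string N lam delta mu m S W ->
  dual_string N lam delta (fun t => - mu t) (fun t => - m t)
    (fun k => - S k) (fun k => - W k).
Proof.
case=> S0 SN Sb up dn Wb incr; split => //.
- by rewrite S0 oppr0.
- by rewrite SN oppr0.
- by move=> k kN; rewrite normrN Sb.
- by move=> k kN; rewrite ltrN2 => /(dn _ kN) ->.
- by move=> k kN; rewrite ltrN2 => /(up _ kN) ->; rewrite opprK.
- by move=> k kN; rewrite normrN Wb.
- by move=> k kN; have := incr k kN; lra.
Qed.

(* Time reversal combined with negation preserves the direction of jumps. *)
Lemma dual_string_flip (R : realFieldType) (N : nat) (lam delta : R)
    (mu m S W : nat -> R) :
  dual_string N lam delta mu m S W ->
  dual_string N lam delta (fun t => - mu (N - t).-1) (fun t => - m (N - t).-1)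
    (fun k => S (N - k)%N) (fun k => W (N - k)%N).
Proof.
case=> S0 SN Sb up dn Wb incr; split => //.
- by rewrite subn0.
- by rewrite subnn.
- by move=> k _; apply: Sb; nat_lia.
- move=> k kN; rewrite ltrN2 => h; apply: up; first by nat_lia.
  by rewrite (_ : N - k.-1 = (N - k).+1)%N in h; [|nat_lia].
- move=> k kN; rewrite ltrN2 => h; apply: dn; first by nat_lia.
  by rewrite (_ : N - k.-1 = (N - k).+1)%N in h; [|nat_lia].
- by move=> k _; apply: Wb; nat_lia.
- move=> k kN; have := incr (N - k.+1)%N.
  rewrite (_ : (N - k.+1).+1 = N - k)%N; last by nat_lia.
  rewrite (_ : (N - k).-1 = N - k.+1)%N; last by nat_lia.
  by move=> /(_ ltac:(nat_lia)); lra.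
Qed.

(** By [ds_incr], [S - W] has increments exactly [mu - m], so the bound telescopes; exchanging
    [S - W] for [S] at the two ends costs [2 * delta]. *)
Lemma dual_string_incr_ge (R : realFieldType) (N : nat) (lam delta : R)
    (mu m S W : nat -> R) (a b : nat) (l : R) :
  dual_string N lam delta mu m S W -> (a <= b <= N)%N ->
  (forall t, (a <= t < b)%N -> l <= mu t - m t) ->
  l * (b%:R - a%:R) <= S b - S a + 2 * delta.
Proof.
move=> H /andP[ab bN] hl.
suff : l * (b%:R - a%:R) <= (S b - W b) - (S a - W a).
  have := ds_noise H bN; have := ds_noise H (leq_trans ab bN).
  by rewrite !ler_norml => /andP[? ?] /andP[? ?]; lra.
elim: b ab bN hl => [|b IH] ab bN hl.
  by move: ab; rewrite leqn0 => /eqP->; rewrite !subrr mulr0.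
move: ab; rewrite leq_eqVlt => /orP[/eqP<-|ab]; first by rewrite !subrr mulr0.
have := IH ab (ltnW bN) (fun t ht => hl t ltac:(nat_lia)).
have := hl b ltac:(nat_lia); have := ds_incr H bN.
by rewrite -natr1; lra.
Qed.

Lemma dual_string_incr_le (R : realFieldType) (N : nat) (lam delta : R)
    (mu m S W : nat -> R) (a b : nat) (l : R) :
  dual_string N lam delta mu m S W -> (a <= b <= N)%N ->
  (forall t, (a <= t < b)%N -> mu t - m t <= l) ->
  S b - S a <= l * (b%:R - a%:R) + 2 * delta.
Proof.
move=> /dual_string_opp H ab hl.
have := @dual_string_incr_ge _ _ _ _ _ _ _ _ a b (- l) H ab.
by move=> /(_ (fun t ht => ltac:(have := hl t ht; lra))); lra.
Qed.

(** * Upward jumps of the fit within one constant segment of the signal *)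

Lemma nondecreasing_run (R : realFieldType) (m : nat -> R) (p k : nat) :
  (p < k)%N -> exists a, [/\ (p <= a < k)%N, a = p \/ (p < a)%N /\ m a < m a.-1
    & forall t, (a < t < k)%N -> m t.-1 <= m t].
Proof.
elim: k => // k IH; rewrite ltnS leq_eqVlt => /orP[/eqP<-|pk].
  by exists p; split; [nat_lia | left | nat_lia].
have [hk|hk] := ltP (m k) (m k.-1).
  by exists k; split; [nat_lia | right | nat_lia].
have [a [pa ha hm]] := IH pk; exists a; split => // [|t]; first by nat_lia.
rewrite ltnS [(t <= k)%N]leq_eqVlt => /andP[at_ /orP[/eqP->//|tk]].
by apply: hm; rewrite at_.
Qed.

Lemma nondecreasing_le (R : realFieldType) (m : nat -> R) (a b : nat) :
  (forall t, (a < t < b)%N -> m t.-1 <= m t) ->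
  forall s t, (a <= s <= t)%N -> (t < b)%N -> m s <= m t.
Proof.
move=> hm s; elim=> [|t IH] st tb.
  by rewrite (_ : s = 0%N); [|nat_lia].
have [->//|st'] := eqVneq s t.+1.
apply: le_trans (IH _ _) _; [nat_lia|nat_lia|].
by apply: (hm t.+1); nat_lia.
Qed.

(* Left of an up-knot [k], the fit runs nondecreasingly back to a point where
   [S >= 0] (a down-knot, or the left boundary) or to the end of the segment. *)
Lemma up_knot_left (R : realFieldType) (N : nat) (lam delta D c : R)
    (mu m S W : nat -> R) (p k : nat) :
  dual_string N lam delta mu m S W -> 0 < D -> 2 * delta < lam ->
  (p < k < N)%N -> (forall t, (p <= t < k)%N -> mu t = c) -> m k.-1 < m k ->
  p = 0%N \/ D <= k%:R - p%:R ->
  lam - 2 * delta <= (m k.-1 - c) * N%:R \/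
  [/\ p <> 0%N, forall t, (p < t < k)%N -> m t.-1 <= m t
    & - (2 * delta) <= (m k.-1 - c) * D].
Proof.
move=> H D0 dl /andP[pk kN] muc mk hp.
have [a [/andP[pa ak] ha hm]] := nondecreasing_run m pk.
have Sk := ds_up H (k := k) ltac:(nat_lia) mk.
have le1 : (c - m k.-1) * (k%:R - a%:R) <= S k - S a + 2 * delta.
  apply: (dual_string_incr_ge H); first by nat_lia.
  move=> t /andP[at_ tk]; rewrite muc; last by nat_lia.
  by rewrite lerB //; apply: (nondecreasing_le hm); nat_lia.
rewrite Sk in le1.
have d0 : 0 <= delta by apply: le_trans (ds_noise H (leq0n N)).
have ka : (0 : R) <= k%:R - a%:R by rewrite subr_ge0 ler_nat ltnW.
have kaN : k%:R - a%:R <= N%:R :> R.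
  by rewrite lerBlDr -natrD ler_nat; nat_lia.
(* Since [S k = - lam], [le1] and [0 <= S a] give [lam - 2 * delta <= (m k.-1 - c) * (k - a)]. The
   left side is positive, hence so is [m k.-1 - c], and [k - a] may be enlarged to [N]. *)
have strong : 0 <= S a -> lam - 2 * delta <= (m k.-1 - c) * N%:R.
  move=> Sa; have [h|h] := leP 0 (m k.-1 - c).
    by have := ler_wpM2l h kaN; lra.
  by have := mulr_le0_ge0 (ltW h) ka; lra.
case: ha => [ap|[pa' ma]]; last first.
  by left; apply: strong; rewrite (ds_down H (k := a)) //; [lra|nat_lia].
subst a; have [p0|/eqP p0] := eqVneq p 0%N.
  by left; apply: strong; rewrite p0 (ds_start H).
(* The run reaches [p], where [- lam <= S p]: the two values [- lam] cancel in [le1] and only the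
   noise term is left. *)
right; split => //; case: hp => // Dk.
have Sp : - lam <= S p.
  by have := ds_bound H (k := p) ltac:(nat_lia); rewrite ler_norml => /andP[].
have [h|h] := leP 0 (m k.-1 - c); first by have := mulr_ge0 h (ltW D0); lra.
by have := ler_wnM2l (ltW h) Dk; lra.
Qed.

Lemma up_knot_right (R : realFieldType) (N : nat) (lam delta D c : R)
    (mu m S W : nat -> R) (q k : nat) :
  dual_string N lam delta mu m S W -> 0 < D -> 2 * delta < lam ->
  (0 < k < q)%N -> (q <= N)%N ->
  (forall t, (k <= t < q)%N -> mu t = c) -> m k.-1 < m k ->
  q = N \/ D <= q%:R - k%:R ->
  lam - 2 * delta <= (c - m k) * N%:R \/
  [/\ q <> N, forall t, (k < t < q)%N -> m t.-1 <= m t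
    & - (2 * delta) <= (c - m k) * D].
Proof.
move=> /dual_string_flip H D0 dl /andP[k0 kq] qN muc mk hq.
have /= := @up_knot_left _ _ _ _ D (- c) _ _ _ _ (N - q)%N (N - k)%N H D0 dl.
rewrite (_ : N - (N - k).-1 = k.+1)%N; last by nat_lia.
rewrite (_ : N - (N - k) = k)%N; last by nat_lia.
rewrite ltrN2 !natrB; [|nat_lia|nat_lia].
have -> : - m k.+1.-1 - - c = c - m k by rewrite /=; lra.
move=> /(_ ltac:(nat_lia)).
move=> /(_ (fun t ht => ltac:(rewrite muc //; nat_lia))) /(_ mk).
case; [case: hq => [->|?]; [left; nat_lia | right; lra] | by left | ].
case=> ? hm ?; right; split => //; first by nat_lia.
move=> t tkq; have := hm (N - t)%N ltac:(nat_lia); rewrite lerN2.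
rewrite (_ : N - (N - t).-1 = t.+1)%N; last by nat_lia.
by rewrite (_ : N - (N - t) = t)%N; last by nat_lia.
Qed.

(** The hypothesis on [D] says that [(lam - 2 * delta) / N] exceeds [2 * delta / D]. As
    [m k.-1 < m k], the strong bound on one side of the jump contradicts either bound on the other
    side, so both sides are in the weak case. Then the fit at the end of the segment is not much
    below [c], and [S q] is close to [- lam]. *)
Lemma up_knot_segment (R : realFieldType) (N : nat) (lam delta D c : R)
    (mu m S W : nat -> R) (p q k : nat) :
  dual_string N lam delta mu m S W -> 0 < D ->
  2 * delta * N%:R < (lam - 2 * delta) * D -> 2 * delta < lam ->
  (p < k < q)%N -> (q <= N)%N ->
  (forall t, (p <= t < q)%N -> mu t = c) -> m k.-1 < m k ->
  p = 0%N \/ D <= k%:R - p%:R -> q = N \/ D <= q%:R - k%:R ->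
  [/\ p <> 0%N, q <> N, (c - m q.-1) * D <= 2 * delta
    & (S q + lam - 2 * delta) * D <= 2 * delta * N%:R].
Proof.
move=> H D0 dN dl /andP[pk kq] qN muc mk hp hq.
have N0 : (0 : R) < N%:R by rewrite ltr0n; nat_lia.
have nk (x y : R) : 0 < x -> 0 < y -> (m k.-1 - m k) * (x * y) < 0.
  by move=> x0 y0; rewrite nmulr_rlt0 ?mulr_gt0// subr_lt0.
have pkN : (p < k < N)%N by nat_lia.
have kqN : (0 < k < q)%N by nat_lia.
have mucp t : (p <= t < k)%N -> mu t = c by move=> ?; apply: muc; nat_lia.
have mucq t : (k <= t < q)%N -> mu t = c by move=> ?; apply: muc; nat_lia.
have [h1|[p0 _ h1]] := up_knot_left H D0 dl pkN mucp mk hp;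
  have [h2|[q0 hm h2]] := up_knot_right H D0 dl kqN qN mucq mk hq.
- by have := nk _ _ N0 ltr01; lra.
- have := nk _ _ N0 D0; have := ler_wpM2r (ltW D0) h1.
  by have := ler_wpM2r (ltW N0) h2; lra.
- have := nk _ _ N0 D0; have := ler_wpM2r (ltW D0) h2.
  by have := ler_wpM2r (ltW N0) h1; lra.
have mkq t : (k <= t < q)%N -> m k <= m t.
  by move=> tkq; apply: (nondecreasing_le hm); nat_lia.
have d0 : 0 <= delta by apply: le_trans (ds_noise H (leq0n N)).
split => //.
  have := mkq q.-1 ltac:(nat_lia); have := nk _ _ D0 ltr01; move=> h3 h4.
  by have := ler_wpM2r (ltW D0) h4; lra.
have : S q - S k <= (c - m k) * (q%:R - k%:R) + 2 * delta.
  apply: (dual_string_incr_le H); first by nat_lia.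
  by move=> t kt; rewrite mucq // lerB // mkq.
rewrite (ds_up H (k := k)) //; last by nat_lia.
move=> h3; have h4 : S q + lam - 2 * delta <= (c - m k) * (q%:R - k%:R) by lra.
have h5 : (c - m k) * D <= 2 * delta by have := nk _ _ D0 ltr01; lra.
have qk : 0 <= q%:R - k%:R :> R by rewrite subr_ge0 ler_nat ltnW.
have qkN : q%:R - k%:R <= N%:R :> R by rewrite lerBlDr -natrD ler_nat; nat_lia.
have := ler_wpM2r (ltW D0) h4; have := ler_wpM2r qk h5.
have := ler_wpM2l (mulr_ge0 (ler0n R 2) d0) qkN; lra.
Qed.

(** As long as [m >= b], the residual is nonpositive and [S] rises by at most [2 * delta], too
    little to reach the value [lam] that a downward jump requires. Hence [m >= b] persists over the
    whole stretch, and there [S] loses [J * L] up to noise, which takes it below [- lam]. *)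
Lemma no_drop_after_low_string (R : realFieldType) (N : nat)
    (lam delta b J : R) (mu m S W : nat -> R) (q L : nat) :
  dual_string N lam delta mu m S W ->
  (0 < q)%N -> (q + L <= N)%N -> b <= m q.-1 -> 0 <= J ->
  (forall t, (q <= t < q + L)%N -> mu t <= b - J) ->
  S q + 2 * delta < lam -> lam + S q + 2 * delta < J * L%:R -> False.
Proof.
move=> H q0 qL mq J0 muJ Sq SqL.
have mb s : (s <= L)%N -> forall t, (q.-1 <= t < q + s)%N -> b <= m t.
  elim: s => [|s IH] sL t qt; first by rewrite (_ : t = q.-1) //; nat_lia.
  have {}IH := IH (ltnW sL).
  have [tqs|tqs] := ltnP t (q + s); first by apply: IH; nat_lia.
  have {qt tqs}-> : t = (q + s)%N by nat_lia.
  have [h|h] := ltP (m (q + s)%N) (m (q + s).-1); last first.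
    by apply: le_trans h; apply: IH; nat_lia.
  have := ds_down H (k := (q + s)%N) ltac:(nat_lia) h.
  have : S (q + s)%N - S q <= 0 * ((q + s)%:R - q%:R) + 2 * delta.
    apply: (dual_string_incr_le H); first by nat_lia.
    move=> u qu; have := muJ u ltac:(nat_lia).
    by have := IH u ltac:(nat_lia); lra.
  by lra.
have : S (q + L)%N - S q <= - J * ((q + L)%:R - q%:R) + 2 * delta.
  apply: (dual_string_incr_le H); first by nat_lia.
  move=> u qu; have := muJ u ltac:(nat_lia).
  by have := mb L (leqnn L) u ltac:(nat_lia); lra.
have := ds_bound H qL; rewrite ler_norml natrD => /andP[]; lra.
Qed.

Lemma up_knot_false_right (R : realFieldType) (N : nat) (lam delta D c J : R)
    (mu m S W : nat -> R) (p q k L : nat) :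
  dual_string N lam delta mu m S W -> 0 < D ->
  2 * delta * N%:R < (lam - 2 * delta) * D -> 2 * delta < lam ->
  4 * lam <= J * L%:R ->
  (p < k < q)%N -> (q <= N)%N ->
  (forall t, (p <= t < q)%N -> mu t = c) -> m k.-1 < m k ->
  p = 0%N \/ D <= k%:R - p%:R -> q = N \/ D <= q%:R - k%:R ->
  p = 0%N \/ q = N \/
    (q + L <= N)%N /\ (forall t, (q <= t < q + L)%N -> mu t <= c - J) ->
  False.
Proof.
move=> H D0 dN dl LJ pkq qN muc mk hp hq.
have [p0 qN' hmq hSq] := up_knot_segment H D0 dN dl pkq qN muc mk hp hq.
case=> [//|[//|[qL hJ]]].
have d0 : 0 <= delta by apply: le_trans (ds_noise H (leq0n N)).
have N0 : (0 : R) < N%:R by rewrite ltr0n; nat_lia.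
have L0 : (0 : R) <= L%:R by [].
have LN : (L%:R : R) <= N%:R by rewrite ler_nat; nat_lia.
have J0 : 0 <= J.
  by have [//|h] := leP 0 J; have := mulr_le0_ge0 (ltW h) L0; lra.
have zD : 2 * delta / D * D = 2 * delta by rewrite mulfVK // gt_eqF.
(* [z] controls both errors left by [up_knot_segment]: [m q.-1] is at least [c - z], and
   [S q + lam - 2 * delta] is at most [z * N]. Measured from the level [c - z] the drop is only
   [J - z], still at least three quarters of [J] by [zJ]. *)
pose z := 2 * delta / D; rewrite -/z in zD.
have zN : z * N%:R < lam - 2 * delta.
  by rewrite -(ltr_pM2r D0) mulrAC zD.
have zJ : 4 * z <= J.
  rewrite -(ler_pM2r N0); have := ler_wpM2l J0 LN; lra.
have hb : c - z <= m q.-1.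
  by rewrite -(ler_pM2r D0); lra.
have hS : S q + lam - 2 * delta <= z * N%:R.
  by rewrite -(ler_pM2r D0) [z * _ * _]mulrAC zD.
have zL : 4 * (z * L%:R) <= J * L%:R by rewrite mulrA ler_wpM2r.
apply: (no_drop_after_low_string (b := c - z) (J := J - z) H _ qL hb).
- by nat_lia.
- by lra.
- by move=> t /hJ; lra.
- by lra.
- by lra.
Qed.

(** Reversal with negation keeps the jump at [k] upward, and turns a higher stretch of signal before
    [p] into a lower stretch after the segment. *)
Lemma up_knot_false_left (R : realFieldType) (N : nat) (lam delta D c J : R)
    (mu m S W : nat -> R) (p q k L : nat) :
  dual_string N lam delta mu m S W -> 0 < D ->
  2 * delta * N%:R < (lam - 2 * delta) * D -> 2 * delta < lam ->
  4 * lam <= J * L%:R ->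
  (p < k < q)%N -> (q <= N)%N ->
  (forall t, (p <= t < q)%N -> mu t = c) -> m k.-1 < m k ->
  p = 0%N \/ D <= k%:R - p%:R -> q = N \/ D <= q%:R - k%:R ->
  (L <= p)%N -> (forall t, (p - L <= t < p)%N -> c + J <= mu t) ->
  False.
Proof.
move=> H D0 dN dl LJ pkq qN muc mk hp hq Lp hJ.
apply: (up_knot_false_right (p := N - q) (q := N - p) (k := N - k) (L := L)
  (c := - c) (J := J) (dual_string_flip H) D0 dN dl LJ).
- by nat_lia.
- by nat_lia.
- by move=> t ht; rewrite muc //; nat_lia.
- rewrite (_ : N - (N - k).-1 = k.+1)%N; last by nat_lia.
  by rewrite (_ : N - (N - k) = k)%N ?ltrN2; last by nat_lia.
- rewrite !natrB; [|nat_lia|nat_lia].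
  by case: hq => [->|?]; [left; nat_lia|right; lra].
- rewrite !natrB; [|nat_lia|nat_lia].
  by case: hp => [->|?]; [left; nat_lia|right; lra].
- right; right; split=> [|t ht]; first by nat_lia.
  by have := hJ (N - t).-1 ltac:(nat_lia); lra.
Qed.

(** Without an upward jump the fit is nonincreasing on the window, so it is at least [m q.-1] on the
    left half and at most [m q.-1] on the right half. Subtracting the two resulting bounds on the
    increments of [S] eliminates [m q.-1]: the increments differ by at least [J * L - 4 * delta],
    whereas [|S| <= lam] lets them differ by at most [4 * lam]. *)
Lemma up_jump_detected (R : realFieldType) (N : nat) (lam delta J c c' : R)
    (mu m S W : nat -> R) (q L : nat) :
  dual_string N lam delta mu m S W ->
  (0 < L <= q)%N -> (q + L <= N)%N -> c + J <= c' ->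
  (forall t, (q - L <= t < q)%N -> mu t = c) ->
  (forall t, (q <= t < q + L)%N -> mu t = c') ->
  4 * lam + 4 * delta < J * L%:R ->
  exists2 k, (q - L < k < q + L)%N & m k.-1 < m k.
Proof.
move=> H /andP[L0 Lq] qL cJ muc muc' JL; apply: contrapT => nk.
have hm t : (q - L < t < q + L)%N -> m t <= m t.-1.
  by move=> tq; rewrite leNgt; apply/negP => h; apply: nk; exists t.
have hm' s t : (q - L <= s <= t)%N -> (t < q + L)%N -> m t <= m s.
  move=> h1 h2; rewrite -lerN2.
  apply: (@nondecreasing_le _ (fun t => - m t) (q - L)%N (q + L)%N _ _ _ h1 h2).
  by move=> u hu; rewrite lerN2; apply: hm.
have : S q - S (q - L)%N <= (c - m q.-1) * (q%:R - (q - L)%:R) + 2 * delta.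
  apply: (dual_string_incr_le H); first by nat_lia.
  by move=> t ht; rewrite muc // lerB // hm' //; nat_lia.
have : (c' - m q.-1) * ((q + L)%:R - q%:R) <= S (q + L)%N - S q + 2 * delta.
  apply: (dual_string_incr_ge H); first by nat_lia.
  by move=> t ht; rewrite muc' // lerB // hm' //; nat_lia.
rewrite natrB // natrD.
have := ds_bound H (k := q) ltac:(nat_lia).
have := ds_bound H (k := (q - L)%N) ltac:(nat_lia).
have := ds_bound H (k := (q + L)%N) ltac:(nat_lia).
rewrite !ler_norml => /andP[? ?] /andP[? ?] /andP[? ?] ? ?.
have : (c + J) * L%:R <= c' * L%:R by rewrite ler_wpM2r.
lra.
Qed.

(** * From a single segment to a signal with alternating jumps *)

Record alternating_signal (R : realFieldType) (N M L : nat) (J : R)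
    (mu : nat -> R) (tau : nat -> nat) : Prop := AlternatingSignal {
  as_start : tau 0%N = 0%N;
  as_end : tau M = N;
  as_long : forall j, (j < M)%N -> (tau j + L <= tau j.+1)%N;
  as_const : forall j, (j < M)%N ->
    forall t, (tau j <= t < tau j.+1)%N -> mu t = mu (tau j);
  as_jump : forall j, (0 < j < M)%N -> J <= `|mu (tau j) - mu (tau j.-1)|;
  as_alt : forall j, (0 < j)%N -> (j.+1 < M)%N ->
    Num.sg (mu (tau j) - mu (tau j.-1)) =
    - Num.sg (mu (tau j.+1) - mu (tau j)) }.

Lemma alternating_signal_opp (R : realFieldType) (N M L : nat) (J : R)
    (mu : nat -> R) (tau : nat -> nat) :
  alternating_signal N M L J mu tau ->
  alternating_signal N M L J (fun t => - mu t) tau.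
Proof.
case=> t0 tM long const jump alt; split => //.
- by move=> j jM t /(const j jM) ->.
- by move=> j /jump; rewrite -opprD normrN.
- by move=> j j0 jM; rewrite -!opprD !sgrN alt.
Qed.

Lemma alternating_signal_tau_le (R : realFieldType) (N M L : nat) (J : R)
    (mu : nat -> R) (tau : nat -> nat) :
  alternating_signal N M L J mu tau ->
  forall j, (j <= M)%N -> (tau j <= N)%N.
Proof.
move=> H j jM; suff : forall i, (j + i <= M)%N -> (tau j <= tau (j + i))%N.
  by move=> /(_ (M - j)%N); rewrite subnKC // (as_end H); apply.
elim=> [|i IH] ij; first by rewrite addn0.
rewrite addnS in ij *; apply: leq_trans (IH (ltnW ij)) _.
by have := as_long H (j := (j + i)%N) ltac:(nat_lia); nat_lia.
Qed.

Lemma alternating_signal_segment (R : realFieldType) (N M L : nat) (J : R)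
    (mu : nat -> R) (tau : nat -> nat) :
  alternating_signal N M L J mu tau -> forall k, (k < N)%N ->
  exists2 j, (j < M)%N & (tau j <= k < tau j.+1)%N.
Proof.
move=> H k kN; suff : forall i, (i <= M)%N -> (k < tau i)%N ->
    exists2 j, (j < M)%N & (tau j <= k < tau j.+1)%N.
  by apply; [exact: leqnn | rewrite (as_end H)].
elim=> [|i IH] iM; first by rewrite (as_start H).
have [ki _|ki ki'] := ltnP k (tau i); first by apply: IH; rewrite // ltnW.
by exists i => //; rewrite ki.
Qed.

Lemma up_knot_near_jump (R : realFieldType) (N M L : nat)
    (lam delta D J : R) (mu m S W : nat -> R) (tau : nat -> nat) (k : nat) :
  dual_string N lam delta mu m S W -> alternating_signal N M L J mu tau ->
  0 < D -> 2 * delta * N%:R < (lam - 2 * delta) * D -> 2 * delta < lam ->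
  4 * lam <= J * L%:R -> (0 < k < N)%N -> m k.-1 < m k ->
  exists2 j, (0 < j < M)%N & `|k%:R - (tau j)%:R| < D.
Proof.
move=> H A D0 dN dl LJ kN mk; apply: contrapT => far.
have farj j : (0 < j < M)%N -> D <= `|k%:R - (tau j)%:R|.
  by move=> jM; rewrite leNgt; apply/negP => h; apply: far; exists j.
have [j jM /andP[jk kj]] :=
  alternating_signal_segment A (k := k) ltac:(nat_lia).
(* A jump of the fit exactly at [tau j] would be at distance zero from a jump of the signal if
   [0 < j], and [k = tau 0 = 0] contradicts [0 < k]. *)
have jk' : (tau j < k)%N.
  rewrite ltn_neqAle jk andbT; apply/negP => /eqP jk'.
  have [j0|j0] := posnP j.
    by move: jk'; rewrite j0 (as_start A) => jk'; move: kN; rewrite -jk'.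
  by have := farj j; rewrite j0 jM jk' subrr normr0 leNgt D0 => /(_ isT).
have jN := alternating_signal_tau_le A jM.
have hp : tau j = 0%N \/ D <= k%:R - (tau j)%:R.
  have [->|j0] := posnP j; first by left; exact: as_start A.
  right; have := farj j; rewrite j0 jM => /(_ isT).
  by rewrite ger0_norm // subr_ge0 ler_nat.
have hq : tau j.+1 = N \/ D <= (tau j.+1)%:R - k%:R.
  have [Mj|Mj] := leqP M j.+1.
    by left; rewrite -(as_end A); congr tau; nat_lia.
  right; have := farj j.+1; rewrite Mj => /(_ isT).
  by rewrite distrC ger0_norm // subr_ge0 ler_nat ltnW.
have muc := as_const A jM.
have jkj : (tau j < k < tau j.+1)%N by rewrite jk'.
have right := up_knot_false_right H D0 dN dl LJ jkj jN muc mk hp hq.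
have [j0|j0] := posnP j.
  by apply: right; left; rewrite j0 (as_start A).
have [Mj|Mj] := leqP M j.+1.
  by apply: right; right; left; rewrite -(as_end A); congr tau; nat_lia.
have := as_jump A (j := j) ltac:(nat_lia).
have := as_jump A (j := j.+1) ltac:(nat_lia).
have := as_alt A j0 Mj; rewrite /=.
have d0 : 0 <= delta by apply: le_trans (ds_noise H (leq0n N)).
have J0 : 0 < J.
  have [//|h] := ltP 0 J.
  by have := mulr_le0_ge0 h (ler0n R L); lra.
(* On an inner segment, either the signal drops at the right end, by at least [J], or it rises there
   and by alternation drops at the left end. *)
have [up|dn] := ltP (mu (tau j)) (mu (tau j.+1)); last first.
  move=> _ hJ _; apply: right; right; right; split.
    have := as_long A (j := j.+1) ltac:(nat_lia).
    by have := alternating_signal_tau_le A Mj; nat_lia.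
  move=> t ht; rewrite (as_const A Mj); last first.
    by have := as_long A (j := j.+1) ltac:(nat_lia); nat_lia.
  by move: hJ; rewrite ler0_norm; lra.
rewrite [in X in _ = X]gtr0_sg ?subr_gt0 // => /eqP.
rewrite sgr_cp0 subr_lt0 => dn _ hJ.
have long := as_long A (j := j.-1) ltac:(nat_lia).
rewrite prednK // in long.
apply: (up_knot_false_left H D0 dN dl LJ jkj jN muc mk hp hq (L := L)).
  by nat_lia.
move=> t ht; rewrite (as_const A (j := j.-1) _ (t := t)); [|nat_lia|]; last first.
  by rewrite prednK //; nat_lia.
by move: hJ; rewrite ltr0_norm ?subr_lt0//; lra.
Qed.

Lemma knot_near_jump (R : realFieldType) (N M L : nat)
    (lam delta D J : R) (mu m S W : nat -> R) (tau : nat -> nat) (k : nat) :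
  dual_string N lam delta mu m S W -> alternating_signal N M L J mu tau ->
  0 < D -> 2 * delta * N%:R < (lam - 2 * delta) * D -> 2 * delta < lam ->
  4 * lam <= J * L%:R -> (0 < k < N)%N -> m k != m k.-1 ->
  exists2 j, (0 < j < M)%N & `|k%:R - (tau j)%:R| < D.
Proof.
move=> H A D0 dN dl LJ kN; rewrite neq_lt => /orP[dn|up].
  apply: (up_knot_near_jump (dual_string_opp H) (alternating_signal_opp A)
    D0 dN dl LJ kN).
  by rewrite ltrN2.
exact: (up_knot_near_jump H A D0 dN dl LJ kN).
Qed.

Lemma up_jump_has_knot (R : realFieldType) (N M L l : nat)
    (lam delta J : R) (mu m S W : nat -> R) (tau : nat -> nat) (j : nat) :
  dual_string N lam delta mu m S W -> alternating_signal N M L J mu tau ->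
  (0 < l <= L)%N -> 4 * lam + 4 * delta < J * l%:R -> (0 < j < M)%N ->
  mu (tau j.-1) < mu (tau j) ->
  exists2 k, (tau j - l < k < tau j + l)%N & m k.-1 < m k.
Proof.
move=> H A lL lJ /andP[j0 jM] up.
have long := as_long A (j := j.-1) ltac:(nat_lia).
rewrite prednK // in long.
have long' := as_long A jM; have jN := alternating_signal_tau_le A jM.
apply: (up_jump_detected (c := mu (tau j.-1)) (c' := mu (tau j))
  H _ _ _ _ _ lJ).
- by nat_lia.
- by nat_lia.
- have := as_jump A (j := j) ltac:(nat_lia).
  by rewrite gtr0_norm ?subr_gt0//; lra.
- by move=> t ht; apply: (as_const A (j := j.-1)); rewrite ?prednK //; nat_lia.
- by move=> t ht; apply: (as_const A jM); nat_lia.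
Qed.

Lemma jump_has_knot (R : realFieldType) (N M L l : nat)
    (lam delta J : R) (mu m S W : nat -> R) (tau : nat -> nat) (j : nat) :
  dual_string N lam delta mu m S W -> alternating_signal N M L J mu tau ->
  (0 < l <= L)%N -> 4 * lam + 4 * delta < J * l%:R -> (0 < j < M)%N ->
  mu (tau j) != mu (tau j.-1) ->
  exists2 k, (tau j - l < k < tau j + l)%N &
    Num.sg (m k - m k.-1) = Num.sg (mu (tau j) - mu (tau j.-1)).
Proof.
move=> H A lL lJ jM; rewrite neq_lt => /orP[dn|up].
  have [|k kj mk] := up_jump_has_knot (dual_string_opp H)
    (alternating_signal_opp A) lL lJ jM; first by rewrite ltrN2.
  by rewrite ltrN2 in mk; exists k; rewrite ?ltr0_sg ?subr_lt0.
have [k kj mk] := up_jump_has_knot H A lL lJ jM up.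
by exists k => //; rewrite !gtr0_sg ?subr_gt0.
Qed.

(** * Partial sums of the noise *)

(** The law of the pair agrees with the product of the two laws on rectangles, hence everywhere, and
    Fubini's theorem factors the expectation of the product. *)
Lemma covariance_independent (d : measure_display) (T : measurableType d)
    (R : realType) (P : probability T R) (X Y : {RV P >-> R}) :
  (forall A B : set R, measurable A -> measurable B ->
     P (X @^-1` A `&` Y @^-1` B) = (P (X @^-1` A) * P (Y @^-1` B))%E) ->
  (X : T -> R) \in Lfun P 2%:E -> (Y : T -> R) \in Lfun P 2%:E ->
  covariance P X Y = 0%E.
Proof.
move=> XY X2 Y2.
have Pfin : P setT \is a fin_num := fin_num_measure P _ measurableT.
have X1 := Lfun_subset12 Pfin X2; have Y1 := Lfun_subset12 Pfin Y2.
have XY1 := Lfun2_mul_Lfun1 X2 Y2.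
rewrite covarianceE //.
suff -> : ('E_P[(X : T -> R) * (Y : T -> R)] = 'E_P[X] * 'E_P[Y])%E.
  by rewrite subee // fin_numM ?expectation_fin_num.
have mZ : measurable_fun setT (fun w => (X w, Y w)).
  by apply/measurable_fun_pairP; split; exact: measurable_funPT.
pose Z : {mfun T >-> (R * R)%type} := mfun_Sub (mem_set mZ).
pose f (p : R * R) := (p.1 * p.2)%:E.
have mf : measurable_fun [set: R * R] f.
  apply/measurable_EFinP; apply: measurable_funM.
    exact: measurable_fst.
  exact: measurable_snd.
have fZ : (f \o Z) = EFin \o (X \* Y) by [].
have intfZ : P.-integrable setT (f \o Z) by rewrite fZ; apply/Lfun1_integrable.
have prodE : forall A, measurable A ->
    (distribution P X \x distribution P Y)%E A = distribution P Z A.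
  apply: product_measure_unique => A B mA mB.
  by rewrite /distribution /= /pushforward -XY //.
(* Fubini's theorem asks for integrability under the product law; it is carried over from [X * Y]
   through the law of the pair. *)
have intf : ((distribution P X \x distribution P Y)%E).-integrable setT f.
  apply/integrableP; split => //.
  rewrite (eq_measure_integral (distribution P Z)) =>
    [|A mA _]; last exact: prodE.
  by have /integrableP[_] := integrable_pushforward mZ mf intfZ measurableT.
have -> : ('E_P[(X : T -> R) * (Y : T -> R)] = \int[P]_w (f \o Z) w)%E.
  by rewrite unlock fZ.
rewrite -integral_distribution //.
rewrite (eq_measure_integral (distribution P X \x distribution P Y)%E) =>
  [|A mA _]; last exact/esym/prodE.
rewrite -integral12_prod_meas1 //=.
have intd (U : {RV P >-> R}) : (U : T -> R) \in Lfun P 1 ->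
    (distribution P U).-integrable [set: R] (@EFin R) /\
    (\int[distribution P U]_x x%:E = 'E_P[U])%E.
  move=> U1; have iU : P.-integrable [set: T] (@EFin R \o U).
    by apply/Lfun1_integrable.
  split; last by rewrite integral_distribution // unlock.
  by apply: (integrable_pushforward (measurable_funPT U) _ iU).
have [iX EX] := intd X X1; have [iY EY] := intd Y Y1.
transitivity (\int[distribution P X]_x (x%:E * 'E_P[Y]))%E.
  apply: eq_integral => x _.
  by rewrite -EY -integralZl //; apply: eq_integral => y _.
have [e He] : exists e, 'E_P[Y]%E = e%:E.
  by exists (fine 'E_P[Y]%E); rewrite fineK ?expectation_fin_num.
by rewrite He integralZr // EX.
Qed.

Lemma covariance_independent_rvs (d : measure_display) (T : measurableType d)
    (R : realType) (P : probability T R) (I : finType) (X : I -> {RV P >-> R}) :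
  independent_rvs X -> (forall i, (X i : T -> R) \in Lfun P 2%:E) ->
  forall i j, i != j -> covariance P (X i) (X j) = 0%E.
Proof.
move=> indX X2 i j ij; apply: covariance_independent => // A B mA mB.
pose C k := if k == i then A else B.
have Ci : C i = A by rewrite /C eqxx.
have Cj : C j = B by rewrite /C eq_sym (negPf ij).
have := indX [set i; j]%SET C.
rewrite (big_setD1 i) ?inE ?eqxx //=.
have -> : ([set i; j] :\ i = [set j])%SET.
  by apply/setP => k; rewrite !inE; case: eqP => // ->; rewrite (negPf ij).
rewrite big_set1 Ci Cj => <-; last by move=> k _; rewrite /C; case: ifP.
congr (P _); apply/seteqP; split => w /=.
  by move=> [Xi Xj] k; rewrite !inE => /orP[]/eqP->; rewrite ?Ci ?Cj.
move=> h; split; [rewrite -Ci | rewrite -Cj]; apply: h;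
  by rewrite !inE eqxx ?orbT.
Qed.

(* Sum of the squares of the sums of [f] over all dyadic blocks of
   [0, 2 ^ n): the Rademacher-Menshov majorant of the squared partial sums. *)
Fixpoint dyadic_sqr (R : pzRingType) (n : nat) (f : nat -> R) : R :=
  if n is n'.+1 then
    dyadic_sqr n' f + dyadic_sqr n' (fun i => f (2 ^ n' + i)%N) +
    (\sum_(i < 2 ^ n'.+1) f i) ^+ 2
  else f 0%N ^+ 2.

Lemma dyadic_sqr_ge0 (R : realFieldType) (n : nat) (f : nat -> R) :
  0 <= dyadic_sqr n f.
Proof.
elim: n f => [|n IH] f /=; first exact: sqr_ge0.
by rewrite !addr_ge0 ?sqr_ge0.
Qed.

Lemma sqr_total_le_dyadic (R : realFieldType) (n : nat) (f : nat -> R) :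
  (\sum_(i < 2 ^ n) f i) ^+ 2 <= dyadic_sqr n f.
Proof.
case: n => [|n] /=; first by rewrite expn0 big_ord1.
by rewrite lerDr addr_ge0 ?dyadic_sqr_ge0.
Qed.

(** A prefix longer than half is the full left half, with sum [B], followed by a prefix of the right
    half, with sum [V]. The weight [c = n.+1] in the inequality for [(B + V) ^+ 2] is the factor
    already lost by [V], so each level raises the factor by just one. *)
Lemma sqr_partial_sum_le_dyadic (R : realFieldType) (n k : nat) (f : nat -> R) :
  (k <= 2 ^ n)%N ->
  (\sum_(i < k) f i) ^+ 2 <= n.+1%:R * dyadic_sqr n f.
Proof.
elim: n k f => [|n IH] k f /= kn.
  case: k kn => [|[|//]] _; rewrite ?big_ord0 ?expr0n /= ?big_ord1 mul1r //.
  exact: sqr_ge0.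
set a := dyadic_sqr n f; set b := dyadic_sqr n _.
set t := (\sum_(i < 2 ^ n.+1) _) ^+ 2.
have a0 : 0 <= a by exact: dyadic_sqr_ge0.
have b0 : 0 <= b by exact: dyadic_sqr_ge0.
have t0 : 0 <= t by exact: sqr_ge0.
have n0 : (0 : R) < n.+1%:R by rewrite ltr0n.
have [kn'|kn'] := leqP k (2 ^ n).
  apply: le_trans (IH _ _ kn') _; rewrite -/a -[n.+2%:R]natr1; nra.
have [k' kE kn2] : exists2 k', k = (2 ^ n + k')%N & (k' <= 2 ^ n)%N.
  exists (k - 2 ^ n)%N; first by rewrite subnKC // ltnW.
  by move: kn; rewrite expnS; lia.
rewrite {k kn kn'}kE big_split_ord /=.
set B := \sum_(i < 2 ^ n) _; set V := \sum_(i < _) _.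
have hB : B ^+ 2 <= a by exact: sqr_total_le_dyadic.
have hV : V ^+ 2 <= n.+1%:R * b by exact: (IH _ (fun i => f (2 ^ n + i)%N) kn2).
rewrite -[n.+2%:R]natr1; set c := n.+1%:R in n0 hV *.
have h : c * (B + V) ^+ 2 <= (c + 1) * (c * B ^+ 2 + V ^+ 2).
  by rewrite -subr_ge0 (_ : _ - _ = (c * B - V) ^+ 2) ?sqr_ge0//; ring.
have h1 : (c + 1) * (c * B ^+ 2 + V ^+ 2) <= c * ((c + 1) * (a + b)).
  have : c * B ^+ 2 <= c * a by rewrite ler_pM2l.
  by move=> h2; rewrite [leRHS]mulrCA ler_wpM2l; lra.
have := le_trans h h1; rewrite ler_pM2l // => h2.
by apply: le_trans h2 _; rewrite ler_pM2l; lra.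
Qed.

(** * Second moments of sums of uncorrelated variables *)

Section uncorrelated_sums.
Context (d : measure_display) (T : measurableType d) (R : realType).
Variable P : probability T R.

Lemma Lfun2_sum (f : nat -> T -> R) (n : nat) :
  (forall i, f i \in Lfun P 2%:E) ->
  (fun w => \sum_(i < n) f i w) \in Lfun P 2%:E.
Proof.
move=> f2; rewrite (_ : (fun w => _) = \sum_(i < n) f i).
  by rewrite rpred_sum // lee1n.
by apply/funext => w; rewrite fct_sumE.
Qed.

Lemma covariance_suml (f : nat -> T -> R) (g : T -> R) (n : nat) :
  (forall i, f i \in Lfun P 2%:E) -> g \in Lfun P 2%:E ->
  (forall i, (i < n)%N -> covariance P (f i) g = 0%E) ->
  covariance P (fun w => \sum_(i < n) f i w) g = 0%E.
Proof.
move=> f2 g2; elim: n => [|n IH] fg.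
  rewrite (_ : (fun w => _) = cst 0%R); last first.
    by apply/funext => w; rewrite big_ord0.
  by rewrite covariance_cst_l.
rewrite (_ : (fun w => _) = (fun w => \sum_(i < n) f i w) \+ f n); last first.
  by apply/funext => w; rewrite big_ord_recr.
rewrite covarianceDl ?Lfun2_sum // IH ?fg ?adde0 // => i ni.
by rewrite fg // ltnW.
Qed.

Lemma variance_sum_le (f : nat -> T -> R) (n : nat) (v : R) :
  (forall i, f i \in Lfun P 2%:E) ->
  (forall i j, i != j -> covariance P (f i) (f j) = 0%E) ->
  (forall i, ('V_P[f i] <= v%:E)%E) ->
  ('V_P[fun w => (\sum_(i < n) f i w)%R] <= (n%:R * v)%:E)%E.
Proof.
move=> f2 ff fv; elim: n => [|n IH].
  rewrite (_ : (fun w => _) = cst 0%R) ?variance_cst ?mul0r //.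
  by apply/funext => w; rewrite big_ord0.
rewrite (_ : (fun w => _) = (fun w => \sum_(i < n) f i w) \+ f n); last first.
  by apply/funext => w; rewrite big_ord_recr.
rewrite varianceD ?Lfun2_sum // covariance_suml // => [|i ni]; last first.
  by rewrite ff // ltn_eqF.
by rewrite mule0 adde0 -natr1 mulrDl mul1r EFinD leeD.
Qed.

Lemma expectation_sum0 (f : nat -> T -> R) (n : nat) :
  (forall i, f i \in Lfun P 1) -> (forall i, 'E_P[f i]%E = 0%E) ->
  ('E_P[fun w => (\sum_(i < n) f i w)%R] = 0)%E.
Proof.
move=> f1 f0; elim: n => [|n IH].
  rewrite (_ : (fun w => _) = cst 0%R) ?expectation_cst //.
  by apply/funext => w; rewrite big_ord0.
rewrite (_ : (fun w => _) = (fun w => \sum_(i < n) f i w) \+ f n); last first.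
  by apply/funext => w; rewrite big_ord_recr.
rewrite expectationD // ?IH ?f0 ?adde0 //.
rewrite (_ : (fun w => _) = \sum_(i < n) f i) ?rpred_sum //.
by apply/funext => w; rewrite fct_sumE.
Qed.

Lemma expectation_sqr_sum_le (f : nat -> T -> R) (n : nat) (v : R) :
  (forall i, f i \in Lfun P 2%:E) -> (forall i, 'E_P[f i]%E = 0%E) ->
  (forall i j, i != j -> covariance P (f i) (f j) = 0%E) ->
  (forall i, ('V_P[f i] <= v%:E)%E) ->
  ('E_P[fun w => ((\sum_(i < n) f i w) ^+ 2)%R] <= (n%:R * v)%:E)%E.
Proof.
move=> f2 f0 ff fv; have := variance_sum_le n f2 ff fv.
rewrite varianceE ?Lfun2_sum // expectation_sum0 // => [|i]; last first.
  by apply: Lfun_subset12 (f2 i); exact: fin_num_measure.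
by rewrite expe2 mule0 sube0.
Qed.

Lemma Lfun1_sqr (g : T -> R) :
  g \in Lfun P 2%:E -> (fun w => g w ^+ 2) \in Lfun P 1.
Proof. by move=> g2; exact: (Lfun2_mul_Lfun1 g2 g2). Qed.

(** There are [n.+1] levels of dyadic blocks. The blocks of one level partition [2 ^ n] indices, and
    without correlations each level contributes at most [2 ^ n * v]. *)
Lemma expectation_dyadic_sqr_le (n : nat) (f : nat -> T -> R) (v : R) :
  (forall i, f i \in Lfun P 2%:E) -> (forall i, 'E_P[f i]%E = 0%E) ->
  (forall i j, i != j -> covariance P (f i) (f j) = 0%E) ->
  (forall i, ('V_P[f i] <= v%:E)%E) ->
  (fun w => dyadic_sqr n (f^~ w)) \in Lfun P 1 /\
  ('E_P[fun w => dyadic_sqr n (f^~ w)] <= ((n.+1 * 2 ^ n)%:R * v)%:E)%E.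
Proof.
elim: n f => [|n IH] f f2 f0 ff fv.
  split; first exact: Lfun1_sqr.
  have := expectation_sqr_sum_le 1 f2 f0 ff fv.
  by under eq_fun do rewrite big_ord1.
have [a1 Ea] := IH f f2 f0 ff fv.
have [||||b1 Eb] := IH (fun i => f (2 ^ n + i)%N); [by []|by []| |by []|].
  by move=> i j ij; rewrite ff // eqn_add2l.
have t1 := Lfun1_sqr (Lfun2_sum (2 ^ n.+1) f2).
have Et := expectation_sqr_sum_le (2 ^ n.+1) f2 f0 ff fv.
set a := (fun w => _) in a1 Ea; set b := (fun w => _) in b1 Eb.
set t := (fun w => _) in t1 Et.
rewrite (_ : (fun w => _) = (a \+ b) \+ t) //.
have ab1 : a \+ b \in Lfun P 1 by rewrite rpredD.
split; first by rewrite rpredD.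
rewrite !expectationD //; apply: le_trans (leeD (leeD Ea Eb) Et) _.
rewrite -!EFinD lee_fin -!mulrDl -!natrD.
suff -> : (n.+1 * 2 ^ n + n.+1 * 2 ^ n + 2 ^ n.+1 = n.+2 * 2 ^ n.+1)%N by [].
by rewrite expnS; lia.
Qed.

End uncorrelated_sums.

(** Markov's inequality is applied to the common majorant, so a single exceptional event serves all
    [k]. One factor [n.+1] comes from the expectation of the majorant, the other from the threshold
    [e]. *)
Lemma partial_sums_maximal_inequality (d : measure_display) (T : measurableType d)
    (R : realType) (P : probability T R) (n : nat) (f : nat -> T -> R)
    (v a : R) :
  (forall i, f i \in Lfun P 2%:E) -> (forall i, 'E_P[f i]%E = 0%E) ->
  (forall i j, i != j -> covariance P (f i) (f j) = 0%E) ->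
  (forall i, ('V_P[f i] <= v%:E)%E) -> 0 < a ->
  exists G, [/\ measurable G,
    ((1 - (n.+1 ^ 2 * 2 ^ n)%:R * v / a ^+ 2)%:E <= P G)%E &
    forall w, G w -> forall k, (k <= 2 ^ n)%N -> `|\sum_(i < k) f i w| <= a].
Proof.
move=> f2 f0 ff fv a0.
have [D1 ED] := expectation_dyadic_sqr_le n f2 f0 ff fv.
set D := (fun w => _) in D1 ED.
have mD : D \in mfun by move: D1; rewrite inE => /andP[].
pose X : {RV P >-> R} := mfun_Sub mD.
pose e := a ^+ 2 / n.+1%:R.
have e0 : 0 < e by rewrite divr_gt0 ?exprn_gt0.
have D0 w : 0 <= D w by exact: dyadic_sqr_ge0.
have mB : measurable [set w | (e%:E <= `|(X w)%:E|)%E].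
  rewrite (_ : [set w | _] = X @^-1` `[e, +oo[%classic).
    by rewrite -[X in measurable X]setTI; apply: measurable_funPT.
  apply/seteqP; split => w /=; rewrite in_itv /= andbT lee_fin ger0_norm //;
    exact: D0.
exists (~` [set w | (e%:E <= `|(X w)%:E|)%E]); split.
- exact: measurableC.
- rewrite probability_setC // EFinB leeB //.
  have h : (e%:E * P [set w | (e%:E <= `|(X w)%:E|)%E] <= 'E_P[D])%E.
    rewrite (_ : D = id \o (fun x => `|x|) \o X); last first.
      by apply/funext => w /=; rewrite ger0_norm // D0.
    by apply: (@markov _ _ _ P X id e e0).
  have := le_trans h ED; rewrite -lee_pdivlMl // => h'.
  apply: le_trans h' _; rewrite -EFinM lee_fin /e invf_div.
  rewrite !natrM natrX.
  by rewrite le_eqVlt; apply/orP; left; apply/eqP; field; rewrite gt_eqF.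
- move=> w /= /negP; rewrite -ltNge lte_fin ger0_norm ?D0 // => hw k kn.
  rewrite -ler_sqr ?nnegrE ?(ltW a0) // real_normK ?num_real //.
  apply: le_trans (sqr_partial_sum_le_dyadic (f^~ w) kn) _.
  by move: hw; rewrite /e ltr_pdivlMr // mulrC => /ltW.
Qed.

(** The exponent 2 in the supremum bounds the L2 norm by [2 * k]; for a centred variable its square
    is the variance. *)
Lemma psi1_norm_variance (d : measure_display) (T : measurableType d)
    (R : realType) (P : probability T R) (X : {RV P >-> R}) (k : R) :
  (psi1_norm X <= k%:E)%E ->
  (X : T -> R) \in Lfun P 2%:E /\
  ('E_P[X] = 0 -> 'V_P[X] <= ((2 * k) ^+ 2)%:E)%E.
Proof.
move=> Xk.
have N2 : ('N[P]_2%:E[EFin \o X] <= (2 * k)%:E)%E.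
  have : ((2^-1)%:E * 'N[P]_2%:E[EFin \o X] <= k%:E)%E.
    apply: le_trans Xk; apply: ereal_sup_ubound; exists 2 => //=; lra.
  by rewrite lee_pdivrMl // EFinM.
have X2 : (X : T -> R) \in Lfun P 2%:E.
  rewrite inE; apply/andP; split.
    by rewrite inE /=; exact: measurable_funPT.
  by rewrite inE /= /finite_norm; apply: le_lt_trans N2 _; rewrite ltry.
split => // X0; rewrite varianceE // X0 expe2 mule0 sube0.
have k0 : 0 <= 2 * k.
  by rewrite -lee_fin; apply: le_trans N2; exact: Lnorm_ge0.
have -> : ('E_P[(X : T -> R) ^+ 2] = 'N[P]_2%:E[EFin \o X] `^ 2)%E.
  rewrite powR_Lnorm // unlock; apply: eq_integral => w _ /=.
  by rewrite -[RHS]/((`|X w| `^ 2)%:E) powR_mulrn // real_normK ?num_real.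
rewrite -powR_mulrn // -poweR_EFin gt0_ler_poweR //.
  by rewrite in_itv /= leey Lnorm_ge0.
by rewrite in_itv /= leey lee_fin k0.
Qed.

(** * Optimality conditions *)

Definition total_variation (R : realType) (N : nat) (m : 'cV[R]_N) : R :=
  \sum_(1 <= t < N) `|entry m t - entry m t.-1|.

Lemma entry_ord (R : realType) (N : nat) (m : 'cV[R]_N) (i : 'I_N) :
  entry m i = m i 0.
Proof. by rewrite /entry valK. Qed.

Lemma entryE (R : realType) (N : nat) (m : 'cV[R]_N) (t : nat) (tN : (t < N)%N) :
  entry m t = m (Ordinal tN) 0.
Proof. by rewrite -entry_ord. Qed.

Lemma entryDZ (R : realType) (N : nat) (m d : 'cV[R]_N) (s : R) (t : nat) :
  entry (m + s *: d) t = entry m t + s * entry d t.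
Proof.
rewrite /entry; case: insub => [i|]; first by rewrite !mxE.
by rewrite mulr0 addr0.
Qed.

Lemma total_variation_convex (R : realType) (N : nat) (m m' : 'cV[R]_N) (s : R) :
  0 <= s <= 1 -> total_variation (m + s *: (m' - m)) <=
    (1 - s) * total_variation m + s * total_variation m'.
Proof.
move=> /andP[s0 s1]; rewrite /total_variation !mulr_sumr -big_split /=.
apply: ler_sum => t _.
have dE u : entry (m' - m) u = entry m' u - entry m u.
  by rewrite -scaleN1r entryDZ mulN1r.
rewrite !entryDZ !dE.
set a := entry m t; set b := entry m t.-1.
set a' := entry m' t; set b' := entry m' t.-1.
have -> : a + s * (a' - a) - (b + s * (b' - b)) =
    (1 - s) * (a - b) + s * (a' - b') by ring.
apply: le_trans (ler_normD _ _) _; rewrite !normrM (ger0_norm s0) ger0_norm //.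
by rewrite subr_ge0.
Qed.

(** First-order optimality of [m] in the direction of [m']: along [m + s *: (m' - m)] the penalty is
    convex and the quadratic term contributes only order [s ^+ 2], so dividing by a small [s] leaves
    the linear terms. *)
Lemma flsa_variational (R : realType) (N : nat) (y m : 'cV[R]_N) (lam : R) :
  0 <= lam -> flsa_solution y lam m -> forall m' : 'cV[R]_N,
  \sum_(t < N) (y t 0 - m t 0) * (m' t 0 - m t 0) <=
    lam * (total_variation m' - total_variation m).
Proof.
move=> lam0 opt m'.
set A := \sum_(t < N) _; set C := lam * _.
pose B := \sum_(t < N) (m' t 0 - m t 0) ^+ 2.
have B0 : 0 <= B by apply: sumr_ge0 => t _; exact: sqr_ge0.
have key s : 0 <= s <= 1 -> s * A <= 2^-1 * s ^+ 2 * B + s * C.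
  move=> s01; have := opt (m + s *: (m' - m)); rewrite /flsa_objective.
  rewrite -!/(total_variation _).
  have := ler_wpM2l lam0 (total_variation_convex m m' s01).
  have -> : \sum_(t < N) (y t 0 - (m + s *: (m' - m)) t 0) ^+ 2 =
      \sum_(t < N) (y t 0 - m t 0) ^+ 2 - 2 * s * A + s ^+ 2 * B.
    rewrite /A /B !mulr_sumr -sumrB -big_split /=; apply: eq_bigr => t _.
    by rewrite !mxE; ring.
  rewrite /C; set U := \sum_(t < N) _; lra.
rewrite leNgt; apply/negP => CA.
have e0 : 0 < A - C by rewrite subr_gt0.
have eB : 0 < A - C + B by apply: ltr_wpDr.
(* This explicit [s] replaces the limit at zero: it is at most 1 and satisfies [s * B < A - C], so
   the quadratic term cannot fill the gap between [A] and [C]. *)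
set s := (A - C) / (A - C + B).
have s0 : 0 < s by rewrite divr_gt0.
have sE : s * (A - C + B) = A - C by rewrite mulfVK // gt_eqF.
have s1 : s <= 1 by rewrite ler_pdivrMr // mul1r lerDl.
have : s * A <= s * (2^-1 * s * B + C).
  by have := key s; rewrite (ltW s0) s1 => /(_ isT); lra.
by rewrite ler_pM2l //; have := mulr_gt0 s0 e0; lra.
Qed.

(** In the sum of the two variational inequalities, each tested at the other solution, the penalties
    cancel. This continuity in the data later yields the measurability of the fit. *)
Lemma flsa_nonexpansive (R : realType) (N : nat) (y y' m m' : 'cV[R]_N)
    (lam r : R) :
  0 <= lam -> flsa_solution y lam m -> flsa_solution y' lam m' ->
  (forall t, `|y' t 0 - y t 0| <= r) ->
  \sum_(t < N) (m' t 0 - m t 0) ^+ 2 <= N%:R * r ^+ 2.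
Proof.
move=> lam0 /(flsa_variational lam0) h /(flsa_variational lam0) h' yr.
have H1 := h m'; have H2 := h' m.
have : \sum_(t < N) (m' t 0 - m t 0) ^+ 2 <=
    \sum_(t < N) (y' t 0 - y t 0) * (m' t 0 - m t 0).
  rewrite -subr_ge0 -sumrB.
  have : 0 <= - (\sum_(t < N) (y t 0 - m t 0) * (m' t 0 - m t 0) +
     \sum_(t < N) (y' t 0 - m' t 0) * (m t 0 - m' t 0)) by lra.
  rewrite -big_split -sumrN /=; congr (0 <= _); apply: eq_bigr => t _; ring.
move=> H3.
have : \sum_(t < N) (y' t 0 - y t 0) * (m' t 0 - m t 0) <=
    \sum_(t < N) (2^-1 * r ^+ 2 + 2^-1 * (m' t 0 - m t 0) ^+ 2).
  apply: ler_sum => t _; have r0 := le_trans (normr_ge0 _) (yr t).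
  have h4 : (y' t 0 - y t 0) ^+ 2 <= r ^+ 2.
    by rewrite -[leLHS]real_normK ?num_real // ler_sqr ?nnegrE.
  have := sqr_ge0 (y' t 0 - y t 0 - (m' t 0 - m t 0)); lra.
rewrite big_split /= -!mulr_sumr sumr_const card_ord -mulr_natl; lra.
Qed.

(** The variational inequality is tested in the direction of a step [e] starting at [k]: its pairing
    with the residual is a tail sum, and it alters the penalty at the one jump [k]. For [k = 0] the
    step is constant and for [k = N] it vanishes, so the penalty does not change. *)
Lemma flsa_step_ineq (R : realType) (N : nat) (y m : 'cV[R]_N) (lam h : R)
    (k : nat) :
  0 <= lam -> flsa_solution y lam m -> (k <= N)%N ->
  h * (\sum_(0 <= t < N) (entry y t - entry m t)
       - \sum_(0 <= t < k) (entry y t - entry m t)) <=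
  lam * (if (0 < k < N)%N then
           `|entry m k - entry m k.-1 + h| - `|entry m k - entry m k.-1|
         else 0).
Proof.
move=> lam0 opt kN.
pose e : 'cV[R]_N := \col_(t < N) (k <= t)%N%:R.
have eE t : (t < N)%N -> entry e t = (k <= t)%N%:R.
  by move=> tN; rewrite entryE mxE.
have := flsa_variational lam0 opt (m + h *: e).
have -> : \sum_(t < N) (y t 0 - m t 0) * ((m + h *: e) t 0 - m t 0) =
    h * (\sum_(0 <= t < N) (entry y t - entry m t)
       - \sum_(0 <= t < k) (entry y t - entry m t)).
  rewrite (big_cat_nat (n := k)) //= addrAC subrr add0r
    (big_nat_widenl _ 0%N) // big_mkord.
  rewrite mulr_sumr [RHS]big_mkcond /=; apply: eq_bigr => t _.
  rewrite !mxE !entry_ord; case: (k <= t)%N => /=; ring.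
have -> // : total_variation (m + h *: e) - total_variation m =
  (if (0 < k < N)%N then
           `|entry m k - entry m k.-1 + h| - `|entry m k - entry m k.-1|
         else 0).
rewrite /total_variation -sumrB.
rewrite -(big_nat1_eq +%R
  (fun k => `|entry m k - entry m k.-1 + h| - `|entry m k - entry m k.-1|)).
rewrite [RHS]big_mkcond /=; apply: eq_big_nat => t /andP[t0 tN].
rewrite !entryDZ !eE //; last by lia.
case: eqVneq => [tk|tk].
  rewrite {t}tk in t0 tN *; rewrite leqnn (_ : (k <= k.-1)%N = false);
    last by apply/negP; lia.
  by congr (`|_| - _); rewrite /= mulr1 mulr0 addr0 addrAC.
have -> : (k <= t)%N = (k <= t.-1)%N by apply/idP/idP; lia.
by rewrite opprD addrACA subrr addr0 subrr.
Qed.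

Lemma flsa_dual_string (R : realType) (N : nat) (y m m0 : 'cV[R]_N)
    (lam delta : R) (e : nat -> R) :
  0 <= lam -> flsa_solution y lam m ->
  (forall t, (t < N)%N -> entry y t = entry m0 t + e t) ->
  (forall k, (k <= N)%N -> `|\sum_(i < k) e i| <= delta) ->
  dual_string N lam delta (entry m0) (entry m)
    (fun k => \sum_(0 <= t < k) (entry y t - entry m t))
    (fun k => \sum_(i < k) e i).
Proof.
move=> lam0 opt yE eb.
have step h k := flsa_step_ineq h lam0 opt (k := k).
set S := (fun k : nat => \sum_(0 <= t < k) (entry y t - entry m t)) in step *.
have S0 : S 0%N = 0 by rewrite /S big_geq.
have SN : S N = 0.
  (* Adding constants of either sign leaves the penalty unchanged, so the residuals sum to zero. *)
  have := step 1 0%N (leq0n _); have := step (-1) 0%N (leq0n _).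
  by rewrite /= -!/(S _) S0 mulr0; lra.
have {}step h k : (0 < k < N)%N -> - (h * S k) <=
    lam * (`|entry m k - entry m k.-1 + h| - `|entry m k - entry m k.-1|).
  move=> kN; have := step h k ltac:(lia).
  by rewrite kN -!/(S _) SN sub0r mulrN.
have Sb k : (k <= N)%N -> `|S k| <= lam.
  move=> kN; have [->|k0] := posnP k; first by rewrite S0 normr0.
  have [kN'|kN'] := leqP N k.
    by rewrite (_ : k = N) ?SN ?normr0 //; lia.
  have := step 1 k ltac:(lia); have := step (-1) k ltac:(lia).
  set x := entry m k - _ => h1 h2; rewrite ler_norml.
  have /(ler_wpM2l lam0) h3 : `|x + 1| - `|x| <= 1.
    by have := ler_normD x 1; rewrite normr1; lra.
  have /(ler_wpM2l lam0) h4 : `|x + -1| - `|x| <= 1.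
    by have := ler_normD x (-1); rewrite normrN normr1; lra.
  by apply/andP; split; lra.
split => //.
(* This [h] removes the jump at [k] entirely, which gives [S k <= - lam]; the other inequality is
   [Sb]. *)
- move=> k kN mk; have := step (- (entry m k - entry m k.-1)) k kN.
  have x0 : 0 < entry m k - entry m k.-1 by rewrite subr_gt0.
  rewrite subrr normr0 sub0r ger0_norm ?(ltW x0) // => h1.
  have := Sb k ltac:(lia); rewrite ler_norml => /andP[h2 _].
  apply/eqP; rewrite eq_le h2 andbT -(ler_pM2l x0); lra.
- move=> k kN mk; have := step (- (entry m k - entry m k.-1)) k kN.
  have x0 : entry m k - entry m k.-1 < 0 by rewrite subr_lt0.
  rewrite subrr normr0 sub0r ler0_norm ?(ltW x0) // => h1.
  have := Sb k ltac:(lia); rewrite ler_norml => /andP[_ h2].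
  apply/eqP; rewrite eq_le h2 /= -(ler_nM2l x0); lra.
- by move=> k kN; rewrite /S big_nat_recr //= yE // big_ord_recr /=; lra.
Qed.

(** * Measurability of the event *)

Lemma measurable_forall_fin (d : measure_display) (T : measurableType d)
    (I : finType) (A : I -> T -> Prop) :
  (forall i, measurable [set w | A i w]) -> measurable [set w | forall i, A i w].
Proof.
move=> mA; rewrite (_ : [set w | _] = \bigcap_(i in [set: I]) [set w | A i w]).
  by apply: fin_bigcap_measurable => //; exact: finite_finset.
by apply/seteqP; split => w /= h i; [move=> _|]; apply: h.
Qed.

Lemma measurable_exists_fin (d : measure_display) (T : measurableType d)
    (I : finType) (A : I -> T -> Prop) :
  (forall i, measurable [set w | A i w]) -> measurable [set w | exists i, A i w].
Proof.
move=> mA; rewrite (_ : [set w | _] = \bigcup_(i in [set: I]) [set w | A i w]).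
  by apply: fin_bigcup_measurable => //; exact: finite_finset.
by apply/seteqP; split => w /= [i]; [|move=> _]; exists i.
Qed.

(** The fit is given outcome by outcome, only through its optimality, so measurability has to come
    from its Lipschitz dependence on the data. The set where [g] exceeds [a] is the countable union
    of those preimages of rational boxes that it contains. *)
Lemma measurable_fun_lipschitz_comp (d : measure_display) (T : measurableType d)
    (R : realType) (N : nat) (Y : T -> 'cV[R]_N) (g : T -> R) (c : R) :
  (forall i, measurable_fun setT (fun w => Y w i 0)) -> 0 < c ->
  (forall w w' r, (forall i, `|Y w' i 0 - Y w i 0| <= r) ->
     `|g w' - g w| <= c * r) ->
  measurable_fun setT g.
Proof.
move=> mY c0 lip mD; apply: (measurability _ (RGenOInfty.measurableE R)) => //.
move=> _ [_ [a ->] <-]; rewrite setTI.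
pose ball (p : 'cV[rat]_N * rat) :=
  [set w | forall i, `|Y w i 0 - ratr (p.1 i 0)| < ratr p.2].
pose F p := if `[< forall w, ball p w -> a < g w >] then ball p else set0.
rewrite (_ : g @^-1` _ = \bigcup_p F p).
  apply: countable_bigcupT_measurable => // p; rewrite /F; case: ifP => // _.
  apply: measurable_forall_fin => i.
  rewrite (_ : [set w | _] = (fun w => Y w i 0) @^-1`
      `]ratr (p.1 i 0) - ratr p.2, ratr (p.1 i 0) + ratr p.2[).
    by rewrite -[X in measurable X]setTI; apply: mY.
  by apply/seteqP; split => w /=; rewrite in_itv /= ltr_distl.
apply/seteqP; split => w /=; last first.
  by move=> [p _]; rewrite /F; case: asboolP => // h /h; rewrite in_itv /= andbT.
rewrite in_itv /= andbT => aw.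
(* Two outcomes in one box of radius [r] have data within [2 * r], so below this radius [g] varies
   by less than [g w - a]. *)
have : 0 < (g w - a) / (2 * c) by rewrite divr_gt0 ?subr_gt0 ?mulr_gt0.
move=> /rat_in_itvoo[r]; rewrite in_itv /= => /andP[r0 rw].
have /choice[q hq] : forall i, exists q : rat, `|Y w i 0 - ratr q| < ratr r.
  move=> i; have : Y w i 0 - ratr r < Y w i 0 + ratr r by lra.
  move=> /rat_in_itvoo[q]; rewrite in_itv /= => hq; exists q.
  by rewrite distrC ltr_distl.
pose p : 'cV[rat]_N * rat := (\col_i q i, r).
have pw : ball p w by move=> i; rewrite /= mxE.
exists p => //; rewrite /F asboolT // => w' pw'.
have := lip w w' (2 * ratr r).
have h : forall i, `|Y w' i 0 - Y w i 0| <= 2 * ratr r.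
  move=> i; have := pw i; have := pw' i; rewrite /= => h1 h2.
  rewrite (le_trans (ler_distD (ratr (p.1 i 0)) _ _)) // [X in _ + X]distrC.
  by move: h1 h2 => /ltW h1 /ltW h2; lra.
move=> /(_ h); move: rw; rewrite ltr_pdivlMr ?mulr_gt0 // => rw.
by rewrite ler_distl => /andP[]; lra.
Qed.

Lemma measurable_sgr_eq (d : measure_display) (T : measurableType d)
    (R : realType) (X : T -> R) (u : R) :
  measurable_fun setT X -> measurable [set w | Num.sg (X w) = Num.sg u].
Proof.
move=> mX.
have pre (A : set R) : measurable A -> measurable (X @^-1` A).
  by move=> mA; rewrite -[X in measurable X]setTI; apply: mX.
case: (sgrP u) => _.
- rewrite (_ : [set w | _] = X @^-1` [set 0]); first exact: pre.
  by apply/seteqP; split => w /= /eqP; rewrite ?sgr_eq0 => /eqP // ->; rewrite sgr0.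
- rewrite (_ : [set w | _] = X @^-1` `]0, +oo[); first exact: pre.
  apply/seteqP; split => w /=; rewrite in_itv /= andbT.
    by move=> /eqP; rewrite sgr_cp0.
  by move=> h; rewrite gtr0_sg.
- rewrite (_ : [set w | _] = X @^-1` `]-oo, 0[); first exact: pre.
  apply/seteqP; split => w /=; rewrite in_itv /=.
    by move=> /eqP; rewrite sgr_cp0.
  by move=> h; rewrite ltr0_sg.
Qed.

Lemma measurable_approx_same_signs (d : measure_display) (T : measurableType d)
    (R : realType) (N : nat) (x : T -> 'cV[R]_N.-1) (x0 : 'cV[R]_N.-1) (e : R) :
  (forall k, measurable_fun setT (fun w => x w k 0)) ->
  measurable [set w | approx_same_signs e (x w) x0].
Proof.
move=> mx; rewrite /approx_same_signs; apply: measurableI.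
  apply: measurable_forall_fin => k.
  case: (boolP (k \in _)) => hk.
    by rewrite (_ : [set w | _] = setT) //; apply/seteqP; split.
  rewrite (_ : [set w | _] = (fun w => x w k 0) @^-1` [set 0]).
    by rewrite -[X in measurable X]setTI; apply: mx.
  by apply/seteqP; split => w /=; [apply|].
apply: measurable_forall_fin => i.
case: (boolP (i \in _)) => hi; last first.
  by rewrite (_ : [set w | _] = setT) //; apply/seteqP; split.
rewrite (_ : [set w | _] = [set w | exists k, k \in index_nbhd e i /\
    Num.sg (x w k 0) = Num.sg (x0 i 0)]); last first.
  apply/seteqP; split => w /=.
    by move=> /(_ isT)[k ? ?]; exists k.
  by move=> [k [? ?]] _; exists k.
apply: measurable_exists_fin => k; case: (boolP (k \in _)) => hk.
  rewrite (_ : [set w | _] = [set w | Num.sg (x w k 0) = Num.sg (x0 i 0)]).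
    exact: measurable_sgr_eq.
  by apply/seteqP; split => w /=; [case|].
by rewrite (_ : [set w | _] = set0) //; apply/seteqP; split => w //= -[].
Qed.

(** * Choice of the sample size and conclusion *)

Lemma powR_unbounded (R : realType) (a B : R) :
  0 < a -> exists N0 : nat, forall N : nat, (N0 <= N)%N -> B <= N%:R `^ a.
Proof.
move=> a0; pose b := Num.max B 1; have b0 : 0 < b by rewrite lt_max ltr01 orbT.
exists (Num.trunc (b `^ a^-1)).+1 => N hN.
have h : b `^ a^-1 <= N%:R.
  by apply: le_trans (ltW (truncnS_gt _)) _; rewrite ler_nat.
have := @ge0_ler_powR R a (ltW a0) _ _ _ _ h.
rewrite -powRrM mulVf ?gt_eqF // powRr1 ?(ltW b0) //.
rewrite !nnegrE powR_ge0 ler0n => /(_ isT isT); apply: le_trans.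
by rewrite le_max lexx.
Qed.

(** This is [1 + x <= expR x] at [x = a * ln N]. *)
Lemma trunc_log_le_powR (R : realType) (a : R) : 0 < a ->
  exists2 C : R, 0 < C &
    forall N : nat, (0 < N)%N -> (trunc_log 2 N).+2%:R <= C * N%:R `^ a.
Proof.
move=> a0; have l2 : 0 < ln 2 :> R by rewrite ln_gt0 // ltr1n.
exists ((a * ln 2)^-1 + 2) => [|N N0]; first by rewrite addr_gt0 ?invr_gt0 ?mulr_gt0.
have al0 : 0 < a * ln 2 by rewrite mulr_gt0.
have NR : (0 : R) < N%:R by rewrite ltr0n.
have h1 : (trunc_log 2 N)%:R * ln 2 <= ln N%:R :> R.
  rewrite mulr_natl -lnXn // ler_ln ?posrE ?exprn_gt0 //.
  by rewrite -natrX ler_nat; case/andP: (trunc_log_bounds (ltnSn 1) N0).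
have h2 : 1 + a * ln N%:R <= N%:R `^ a.
  by rewrite /powR gt_eqF //; exact: expR_ge1Dx.
have h3 : (trunc_log 2 N)%:R <= (a * ln 2)^-1 * N%:R `^ a.
  rewrite mulrC ler_pdivlMr //; have := ler_wpM2l (ltW a0) h1; lra.
have lN : 0 <= ln N%:R :> R by rewrite ln_ge0 // ler1n.
by rewrite -addn2 natrD; have := mulr_ge0 (ltW a0) lN; lra.
Qed.

Lemma sample_size (R : realType) (e gamma th v M2 M3 M5 c1 : R) :
  0 < e -> 0 < gamma -> 0 < th <= 1 / 4 -> 0 <= v -> 0 < M2 -> 0 < M3 ->
  0 < M5 -> 1 / 2 < c1 < 1 ->
  exists N0 : nat, forall N : nat, (0 < N)%N -> (N0 <= N)%N ->
    let lam := M5 * N%:R `^ c1 in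
    exists n L : nat, [/\ (N <= 2 ^ n)%N,
      (n.+1 ^ 2 * 2 ^ n)%:R * v / (th * lam) ^+ 2 <= gamma,
      (0 < L)%N, L%:R <= M2 * N%:R & L%:R <= e * N%:R /\
      4 * lam + 4 * (th * lam) < M3 * L%:R].
Proof.
move=> e0 g0 /andP[th0 th4] v0 M20 M30 M50 /andP[c12 c11].
have min0 : 0 < Num.min M2 e by rewrite lt_min M20.
pose b := Num.min M2 e / 2; have b0 : 0 < b by rewrite divr_gt0.
have bM2 : 2 * b <= M2 by rewrite /b mulrC mulfVK // ge_min lexx.
have be : 2 * b <= e by rewrite /b mulrC mulfVK // ge_min lexx orbT.
pose a := (2 * c1 - 1) / 4; have a0 : 0 < a by rewrite divr_gt0 //; lra.
have [C C0 hC] := trunc_log_le_powR a0.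
pose K := 2 * C ^+ 2 * v / (th * M5) ^+ 2.
have K0 : 0 <= K.
  by rewrite divr_ge0 ?sqr_ge0 // mulr_ge0 // mulr_ge0 // sqr_ge0.
have [Na hNa] := powR_unbounded (Num.max 1 (K / gamma)) a0.
have c0 : 0 < 1 - c1 by lra.
(* As [th <= 1 / 4], at most [5 * lam] must stay below [M3 * L]. Rounding [b * N] down to [L] keeps
   at least half of it once [2 / b <= N], so [11 * lam <= M3 * b * N] suffices. *)
have [Nc hNc] := powR_unbounded (11 * M5 / (M3 * b)) c0.
have [Nb hNb] := powR_unbounded (2 / b) (@ltr01 R).
exists (Na + Nb + Nc)%N => N N0 hN.
set p := N%:R `^ c1; move=> lam.
have NR : (0 : R) < N%:R by rewrite ltr0n.
have {}hNa := hNa N ltac:(nat_lia); have {}hNb := hNb N ltac:(nat_lia).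
have {}hNc := hNc N ltac:(nat_lia); have {}hC := hC N N0.
set x := N%:R `^ a in hNa hC.
have p0 : 0 < p by rewrite powR_gt0.
have x1 : 1 <= x by apply: le_trans hNa; rewrite le_max lexx.
have x0 : 0 < x by apply: lt_le_trans x1.
have Kx : K <= gamma * x.
  rewrite mulrC -ler_pdivrMr //; apply: le_trans hNa.
  by rewrite le_max lexx orbT.
have p2 : p ^+ 2 = N%:R * x ^+ 4.
  rewrite -!powR_mulrn ?powR_ge0 // /p /x -!powRrM.
  rewrite -[X in _ = X * _](powRr1 (ler0n R N)).
  rewrite -powRD; last by rewrite (gt_eqF NR) implybT.
  by congr (_ `^ _); rewrite /a; field.
rewrite powRr1 ?ler0n // ler_pdivrMr // in hNb.
have pN : p * N%:R `^ (1 - c1) = N%:R.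
  rewrite /p -powRD; last by rewrite (gt_eqF NR) implybT.
  by rewrite addrC subrK powRr1 ?ler0n.
rewrite ler_pdivrMr ?mulr_gt0 // in hNc.
have {}hNc := ler_wpM2l (ltW p0) hNc; rewrite [leRHS]mulrA pN in hNc.
have bN0 : 0 <= b * N%:R by rewrite mulr_ge0 // ltW.
have /andP[L1 L2] := truncn_itv bN0.
set L := Num.trunc (b * N%:R) in L1 L2.
rewrite -natr1 in L2.
exists (trunc_log 2 N).+1, L; split.
- by case/andP: (trunc_log_bounds (ltnSn 1) N0) => _ /ltnW.
- have NR0 := ltW NR.
  rewrite ler_pdivrMr ?exprn_gt0 ?mulr_gt0 // /lam mulrA exprMn p2.
  have h1 : (2 ^ (trunc_log 2 N).+1)%:R <= 2 * N%:R :> R.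
    rewrite expnS natrM ler_wpM2l // ler_nat.
    by case/andP: (trunc_log_bounds (ltnSn 1) N0).
  have h2 : ((trunc_log 2 N).+2 ^ 2)%:R <= (C * x) ^+ 2 :> R.
    rewrite natrX; apply: lerXn2r => //; rewrite nnegrE ?ler0n //.
    by rewrite mulr_ge0 ?(ltW C0) ?(ltW x0).
  rewrite natrM; apply: (@le_trans _ _ ((C * x) ^+ 2 * (2 * N%:R) * v)).
    by rewrite ler_wpM2r // ler_pM.
  have KE : 2 * C ^+ 2 * v = K * (th * M5) ^+ 2.
    by rewrite /K mulfVK // sqrf_eq0 gt_eqF // mulr_gt0.
  have -> : (C * x) ^+ 2 * (2 * N%:R) * v =
      2 * C ^+ 2 * v * (N%:R * x ^+ 2) by ring.
  have -> : gamma * ((th * M5) ^+ 2 * (N%:R * x ^+ 4)) =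
      gamma * x ^+ 2 * ((th * M5) ^+ 2 * (N%:R * x ^+ 2)) by ring.
  rewrite KE -[leLHS]mulrA; apply: ler_wpM2r.
    by apply: mulr_ge0 (sqr_ge0 _) (mulr_ge0 NR0 (sqr_ge0 _)).
  apply: le_trans Kx _; apply: ler_wpM2l; first exact: ltW.
  by rewrite expr2 ler_peMr // (ltW x0).
- by rewrite -(ltr0n R); lra.
- by apply: le_trans L1 _; rewrite ler_wpM2r //; lra.
- split; first by apply: le_trans L1 _; rewrite ler_wpM2r //; lra.
  have h : 0 < lam by rewrite mulr_gt0.
  have : th * lam <= 1 / 4 * lam by rewrite ler_wpM2r // ltW.
  have := ler_wpM2l (ltW M30) (ltW L2).
  have : M3 * (b * N%:R - 1) >= M3 * (b * N%:R / 2).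
    by apply: ler_wpM2l; [exact: ltW|lra].
  by rewrite /lam in h *; lra.
Qed.

(** * From change points and noise bounds to the event *)

Lemma change_points_alternating (R : realType) (N M L : nat) (m : 'cV[R]_N)
    (tau : nat -> nat) (J : R) :
  change_points m M tau ->
  (forall k, (1 <= k <= M)%N -> (tau k.-1 + L <= tau k)%N) ->
  (forall k, (0 < k < M)%N ->
     J <= `|entry m (tau k) - entry m (tau k).-1|) ->
  (forall k, (1 <= k)%N -> (k.+2 <= M)%N ->
     jump_sign m tau k = - jump_sign m tau k.+1) ->
  alternating_signal N M L J (entry m) tau.
Proof.
move=> [tau0 tauM inc cp] long jump alt.
have mono i j : (i <= j <= M)%N -> (tau i <= tau j)%N.
  case/andP; elim: j => [|j IH]; first by rewrite leqn0 => /eqP->.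
  rewrite leq_eqVlt => /orP[/eqP->//|ij] jM.
  exact: leq_trans (IH ij (ltnW jM)) (ltnW (inc j jM)).
have const j : (j < M)%N -> forall t, (tau j <= t < tau j.+1)%N ->
    entry m t = entry m (tau j).
  move=> jM; elim=> [|t IH] /andP[jt tj].
    by move: jt; rewrite leqn0 => /eqP->.
  move: jt; rewrite leq_eqVlt => /orP[/eqP->//|jt].
  rewrite -IH; last by rewrite -ltnS jt ltnW.
  have tN : (t.+1 < N)%N.
    by rewrite -tauM; apply: leq_trans tj _; apply: mono; rewrite jM leqnn.
  apply/eqP; apply: contraT => ne.
  have /cp[k kM tk] : change_point m t.+1 by rewrite /change_point tN.
  have [kj|jk] := leqP k j.
    by have := mono k j ltac:(by rewrite kj ltnW); rewrite -tk leqNgt jt.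
  have := mono j.+1 k ltac:(nat_lia); rewrite -tk leqNgt tj //.
split=> //.
- by move=> j jM; apply: (long j.+1).
(* The hypothesis compares with the entry at [(tau j).-1], [as_jump] with the one at [tau j.-1];
   both indices lie in the same constant segment. *)
- move=> j jM; have := jump j jM; congr (_ <= `|_ - _|).
  have inc' := inc j.-1 ltac:(nat_lia).
  apply: const; first nat_lia.
  by rewrite prednK in inc' *; nat_lia.
Qed.

Lemma mem_supp_diffv (R : realType) (N : nat) (m : 'cV[R]_N) (i : 'I_N.-1) :
  (i \in supp (Defs.diffv m)) = (entry m i.+1 != entry m i).
Proof. by rewrite inE mxE subr_eq0. Qed.

(** This isolates what holds at a single outcome with small partial noise sums: [knot_near_jump]
    with tolerance [e * N] gives the first clause, [jump_has_knot] with window [L] the second. *)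
Lemma approx_same_signs_bounded_noise (R : realType) (N M L : nat)
    (y m m0 : 'cV[R]_N) (z : nat -> R) (lam delta e J : R) (tau : nat -> nat) :
  0 <= lam -> flsa_solution y lam m ->
  (forall t, (t < N)%N -> entry y t = entry m0 t + z t) ->
  (forall k, (k <= N)%N -> `|\sum_(i < k) z i| <= delta) ->
  change_points m0 M tau -> alternating_signal N M L J (entry m0) tau ->
  0 < e -> 0 < N%:R :> R -> 2 * delta < (lam - 2 * delta) * e -> 2 * delta < lam ->
  (0 < L)%N -> L%:R <= e * N%:R -> 4 * lam + 4 * delta < J * L%:R ->
  approx_same_signs e (Defs.diffv m) (Defs.diffv m0).
Proof.
move=> lam0 opt yE zb [_ _ _ cp] A e0 N0 de dl L0 Le LJ.
have H := flsa_dual_string lam0 opt yE zb.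
have d0 : 0 <= delta by apply: le_trans (zb 0%N (leq0n N)).
have D0 : 0 < e * N%:R by rewrite mulr_gt0.
have dN : 2 * delta * N%:R < (lam - 2 * delta) * (e * N%:R).
  by rewrite mulrA ltr_pM2r.
split=> [k|i].
  apply: contraNeq; rewrite mxE subr_eq0 => xk.
  have kN : (0 < k.+1 < N)%N by have := ltn_ord k; nat_lia.
  have [|j jM jk] := knot_near_jump H A D0 dN dl _ kN xk; first by lra.
  have : change_point m0 (tau j) by apply/cp; exists j => //; nat_lia.
  case/andP => /andP[tj tjN] cj.
  (* Entry [i] of the difference vector is the jump at [i.+1]; the shift affects both indices and
     cancels in their distance. *)
  have ij : ((tau j).-1 < N.-1)%N by nat_lia.
  apply/bigcupP; exists (Ordinal ij).
    by rewrite mem_supp_diffv /= prednK.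
  rewrite inE /=; move: jk; rewrite -(prednK tj) /= -!natr1.
  by congr (`|_| < _); ring.
rewrite mem_supp_diffv => xi.
have /cp[j jM ij] : change_point m0 i.+1.
  by rewrite /change_point xi andbT; have := ltn_ord i; nat_lia.
have jM' : (0 < j < M)%N by nat_lia.
have L0R : (0 : R) < L%:R by rewrite ltr0n.
have J0 : 0 < J by rewrite -(pmulr_lgt0 _ L0R); lra.
have ne : entry m0 (tau j) != entry m0 (tau j.-1).
  by rewrite -subr_eq0 -normr_gt0; apply: lt_le_trans J0 (as_jump A jM').
have LL : (0 < L <= L)%N by rewrite L0 leqnn.
have [k kj sk] := jump_has_knot H A LL LJ jM' ne.
have long := as_long A (j := j.-1) ltac:(nat_lia).
have long' := as_long A (j := j) ltac:(nat_lia).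
have tN := alternating_signal_tau_le A (j := j.+1) ltac:(nat_lia).
rewrite prednK in long; last by nat_lia.
have kN : (k.-1 < N.-1)%N by nat_lia.
have k0 : (0 < k)%N by nat_lia.
exists (Ordinal kN).
  rewrite inE /=; apply: lt_le_trans Le.
  have -> : (k.-1)%:R - i%:R = k%:R - (tau j)%:R :> R.
    by rewrite -ij -[in RHS](prednK k0) -!natr1; ring.
  rewrite ltr_distl -natrB; last by nat_lia.
  by rewrite -natrD !ltr_nat; nat_lia.
rewrite !mxE /= prednK // sk ij.
by rewrite (as_const A (j := j.-1) _ (t := i)) //; [|rewrite prednK]; nat_lia.
Qed.

Lemma kappa_bound (R : realType) (d : nat -> measure_display)
    (T : forall N, measurableType (d N)) (P : forall N, probability (T N) R)
    (eps : forall N, 'I_N -> {RV (P N) >-> R}) :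
  (ereal_sup [set \big[maxe/-oo]_(i < N) psi1_norm (eps N i)
             | N in [set N : nat | (0 < N)%N]] < +oo)%E ->
  exists k : R, forall N i, (psi1_norm (eps N i) <= k%:E)%E.
Proof.
set s := ereal_sup _ => sfin; exists (fine s) => N i.
have les : (psi1_norm (eps N i) <= s)%E.
  apply: (@le_trans _ _ (\big[maxe/-oo]_(i < N) psi1_norm (eps N i))%E).
    exact: (le_bigmax (-oo)%E (fun i => psi1_norm (eps N i)) i).
  by apply: ereal_sup_ubound; exists N => //=; case: N i => [[]|].
(* Nonnegativity of one norm excludes the value [-oo] for the supremum, so that [fine] returns it
   faithfully. *)
have p0 : (0 <= psi1_norm (eps N i))%E.
  apply: (@le_trans _ _ ((1^-1)%:E * 'N[P N]_(1%:E)[EFin \o eps N i])%E).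
    by rewrite mule_ge0 ?Lnorm_ge0 // lee_fin invr_ge0.
  by apply: ereal_sup_ubound; exists 1 => /=.
by rewrite fineK // ge0_fin_numE // (le_trans p0).
Qed.

Section noise.
Context (d : measure_display) (T : measurableType d) (R : realType).
Variables (P : probability T R) (N : nat) (X : 'I_N -> {RV P >-> R}).

(** Zero padding beyond [N] lets the dyadic blocks run up to a power of two; the constant zero is
    centred and uncorrelated with everything, so the moment hypotheses survive. *)
Definition noise (t : nat) (w : T) : R :=
  if insub t is Some i then X i w else 0.

Lemma noise_ord (i : 'I_N) (w : T) : noise i w = X i w.
Proof. by rewrite /noise valK. Qed.

Lemma noise_cases (t : nat) :
  (exists2 i : 'I_N, t = i & noise t = X i) \/ noise t = cst 0.
Proof.
have [tN|Nt] := ltnP t N.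
  by left; exists (Ordinal tN) => //; apply/funext => w; rewrite -noise_ord.
by right; apply/funext => w; rewrite /noise insubF // ltnNge Nt.
Qed.

Lemma noise_maximal_inequality (k a : R) (n : nat) :
  independent_rvs X -> (forall i, 'E_P[X i] = 0)%E ->
  (forall i, (psi1_norm (X i) <= k%:E)%E) -> 0 < a -> (N <= 2 ^ n)%N ->
  exists G, [/\ measurable G,
    ((1 - (n.+1 ^ 2 * 2 ^ n)%:R * (2 * k) ^+ 2 / a ^+ 2)%:E <= P G)%E &
    forall w, G w -> forall j, (j <= N)%N -> `|\sum_(i < j) noise i w| <= a].
Proof.
move=> indep mean0 Xk a0 Nn.
have X2 i : (X i : T -> R) \in Lfun P 2%:E by have [] := psi1_norm_variance (Xk i).
have Z2 t : noise t \in Lfun P 2%:E.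
  by have [[i _ ->]|->] := noise_cases t; [exact: X2|exact: Lfun_cst].
have [| | |G [mG PG hG]] :=
    @partial_sums_maximal_inequality _ _ _ P n noise ((2 * k) ^+ 2) a Z2 _ _ _ a0.
- move=> t; have [[i _ ->]|->] := noise_cases t; first exact: mean0.
  exact: expectation_cst.
- move=> s t st; have [[i si ->]|->] := noise_cases s; last first.
    exact: covariance_cst_l.
  have [[j tj ->]|->] := noise_cases t; last exact: covariance_cst_r.
  apply: covariance_independent_rvs => //.
  by apply: contra_neq st; rewrite si tj => ->.
- move=> t; have [[i _ ->]|->] := noise_cases t.
    by have [_] := psi1_norm_variance (Xk i); apply.
  by rewrite variance_cst lee_fin sqr_ge0.
- by exists G; split => // w Gw j jN; apply: hG => //; exact: leq_trans Nn.
Qed.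

End noise.

Lemma measurable_diffv_flsa (d : measure_display) (T : measurableType d)
    (R : realType) (N : nat) (y m : T -> 'cV[R]_N) (lam : R) :
  0 <= lam -> (forall i, measurable_fun setT (fun w => y w i 0)) ->
  (forall w, flsa_solution (y w) lam (m w)) ->
  forall k, measurable_fun setT (fun w => Defs.diffv (m w) k 0).
Proof.
move=> lam0 my opt.
have mm i : measurable_fun setT (fun w => m w i 0).
  (* One squared coordinate is at most the whole sum, hence at most [N * r ^+ 2], which is below
     [(N * r) ^+ 2]. *)
  apply: (measurable_fun_lipschitz_comp (c := N%:R) my).
    by rewrite ltr0n; case: N i {y m my opt} => [[]|].
  move=> w w' r hr; have := flsa_nonexpansive lam0 (opt w) (opt w') hr.
  have r0 : 0 <= r by apply: le_trans (hr i).
  have N1 : 1 <= N%:R :> R by rewrite ler1n; case: N i {y m my opt hr} => [[]|].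
  rewrite (bigD1 i) //= => h.
  have h1 : (m w' i 0 - m w i 0) ^+ 2 <= N%:R * r ^+ 2.
    by apply: le_trans h; rewrite lerDl sumr_ge0 // => j _; exact: sqr_ge0.
  rewrite -ler_sqr ?nnegrE ?mulr_ge0 // real_normK ?num_real //.
  apply: le_trans h1 _; rewrite exprMn ler_wpM2r ?sqr_ge0 //.
  by rewrite expr2 ler_peMr.
move=> k; have kN : (k.+1 < N)%N by have := ltn_ord k; nat_lia.
rewrite (_ : (fun w => _) = (fun w => m w (Ordinal kN) 0) \-
    (fun w => m w (Ordinal (ltnW kN)) 0)); first exact: measurable_funB.
by apply/funext => w; rewrite mxE entryE (entryE _ (ltnW kN)).
Qed.

Theorem theorem2p2 (R : realType)
  (d : nat -> measure_display) (T : forall N, measurableType (d N))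
  (P : forall N, probability (T N) R)
  (m0 : forall N, 'cV[R]_N)
  (eps : forall N, 'I_N -> {RV (P N) >-> R})
  (y : forall N, T N -> 'cV[R]_N)
  (y_def : forall N (w : T N), y N w = m0 N + \col_(i < N) eps N i w)
  (eps_indep : forall N, independent_rvs (eps N))
  (eps_mean0 : forall N (i : 'I_N), ('E_(P N)[eps N i] = 0)%E)
  (eps_subexp : forall N (i : 'I_N), sub_exponential (eps N i))
  (eps_cont : forall N (i : 'I_N), continuous_rv (eps N i))
  (kappa_fin :
    (ereal_sup [set \big[maxe/-oo]_(i < N) psi1_norm (eps N i)
               | N in [set N : nat | (0 < N)%N]] < +oo)%E)
  (M0 : nat -> nat) (t0 : nat -> nat -> nat)
  (t0_change_points : forall N, (0 < N)%N -> change_points (m0 N) (M0 N) (t0 N))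
  (M1 M2 M3 M4 M5 c1 : R)
  (M1_gt0 : 0 < M1) (M2_gt0 : 0 < M2) (M3_gt0 : 0 < M3) (M4_gt0 : 0 < M4)
  (M5_gt0 : 0 < M5) (c1_gt0 : 0 < c1)
  (ha : forall N, (0 < N)%N -> (M0 N)%:R <= M1)
  (hb : forall N, (0 < N)%N -> forall k, (1 <= k <= M0 N)%N ->
     M2 * N%:R <= (t0 N k)%:R - (t0 N k.-1)%:R)
  (* the minimum ranges over a nonempty set iff 1 < M0 N *)
  (hc : forall N, (0 < N)%N -> (1 < M0 N)%N ->
     (M3%:E <= \big[mine/+oo]_(1 <= k < M0 N)
                 (`|entry (m0 N) (t0 N k) - entry (m0 N) (t0 N k).-1|%R)%:E
            <= M4%:E)%E)
  (lam : nat -> R)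
  (hd_lam : forall N, (0 < N)%N -> lam N = M5 * N%:R `^ c1)
  (hd_c1 : 1 / 2 < c1 < 1)
  (he : forall N, (0 < N)%N -> forall k, (1 <= k)%N -> (k.+2 <= M0 N)%N ->
     jump_sign (m0 N) (t0 N) k = - jump_sign (m0 N) (t0 N) k.+1)
  (m : forall N, T N -> 'cV[R]_N)
  (m_opt : forall N, (0 < N)%N -> forall w : T N,
     flsa_solution (y N w) (lam N) (m N w)) :
  eps_sign_consistent P m m0.
Proof.
move=> e gamma e0 g0; have [k kE] := kappa_bound kappa_fin.
(* The noise level is [delta = th * lam]. The requirement [2 * delta < (lam - 2 * delta) * e]
   amounts to [2 * th * (1 + e) < e], and here the left side is [e / 2]. *)
pose th := e / (4 * (1 + e)).
have e1 : 0 < 4 * (1 + e) by lra.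
have th0 : 0 < th by rewrite divr_gt0.
have thE : th * (4 * (1 + e)) = e by rewrite /th mulfVK // gt_eqF.
have th4 : th <= 1 / 4 by rewrite ler_pdivrMr //; lra.
have th04 : 0 < th <= 1 / 4 by rewrite th0.
have [N0 hN0] :=
  sample_size e0 g0 th04 (sqr_ge0 (2 * k)) M2_gt0 M3_gt0 M5_gt0 hd_c1.
exists N0 => N N_gt0 leN.
have [n [L [Nn Pn L0 LM2 [Le LM3]]]] := hN0 N N_gt0 leN.
rewrite -(hd_lam _ N_gt0) in Pn LM3.
have lam0 : 0 < lam N by rewrite hd_lam // mulr_gt0 // powR_gt0 // ltr0n.
have thlam0 : 0 < th * lam N by rewrite mulr_gt0.
have [G [mG PG hG]] := noise_maximal_inequality (eps_indep N) (eps_mean0 N)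
  (kE N) thlam0 Nn.
have cp := t0_change_points _ N_gt0; have [cp0 cpM cpinc _] := cp.
have alt : alternating_signal N (M0 N) L M3 (entry (m0 N)) (t0 N).
  apply: change_points_alternating => // [j jM|j jM|]; last exact: (he _ N_gt0).
    have := le_trans LM2 (hb _ N_gt0 _ jM).
    by rewrite lerBrDl -natrD ler_nat.
  have /andP[h _] := hc _ N_gt0 (ltac:(nat_lia) : (1 < M0 N)%N).
  rewrite -lee_fin; apply: le_trans h _.
  by apply: ge_bigmin_seq => //; rewrite mem_index_iota.
apply: (@le_trans _ _ (P N G)).
  by apply: le_trans PG; rewrite lee_fin; lra.
(* Monotonicity of the measure requires the event itself to be measurable, which rests on the
   Lipschitz dependence of the fit on the data. *)
apply: le_measure; rewrite ?inE //.
  apply: measurable_approx_same_signs; 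
    apply: (measurable_diffv_flsa (y := y N) (ltW lam0)).
    move=> i; under eq_fun do rewrite y_def !mxE.
    by apply: measurable_funD => //; exact: measurable_funPT.
  exact: (m_opt _ N_gt0).
move=> w Gw; apply: (approx_same_signs_bounded_noise
  (z := fun t => noise (eps N) t w) (ltW lam0) (m_opt _ N_gt0 w)
  _ (hG w Gw) cp alt e0 _ _ _ L0 Le).
- move=> t tN; rewrite y_def !entryE !mxE.
  by rewrite -(noise_ord (eps N) (Ordinal tN)).
- by rewrite ltr0n.
- have := mulr_gt0 thlam0 e0; have : th * lam N * (4 * (1 + e)) = e * lam N.
    by rewrite mulrAC thE.
  have := mulr_gt0 e0 lam0; nra.
- have : th * lam N <= 1 / 4 * lam N by rewrite ler_wpM2r // ltW.
  by lra.
- by lra.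
Qed.
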